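(* Let $W$ be a Weyl group with crystallographic root system $\Phi$, $c$ a Coxeter element of $W$, and suppose $\pmb a\in L$ lies in the interior of the fundamental chamber. Then the vertex sets of $\mathrm{Perm}^{\pmb a}(W)$ and of $\mathrm{Ass}^{\pmb a}_c(W)$ are contained in $L$.
   Context: $W$ acts essentially on a Euclidean space $V$ with simple roots $\{\alpha_s\}_{s\in S}$ (a basis of $V$) and fundamental weights $\{v_s\}$ (dual basis). Crystallographic: for roots $\alpha,\beta$, $s_\alpha(\beta)=\beta+\lambda\alpha$ with $\lambda\in\mathbb Z$. $L$ is the lattice spanned by the simple roots. Fundamental chamber $D=\{v:\langle v,\alpha_s\rangle\ge0\}$, $\rho_s=\mathbb R_{\ge0}v_s$; the Coxeter fan $\mathcal F$ consists of chambers $w(D)$ and faces. $c$-sortable elements and $\pi^c_\downarrow$: with $c$ a product of all simple reflections once (reduced expression fixed), $c_{(I)}$ the subword with letters in $I$, the $c$-sorting word of $w$ is the lexicographically first reduced subword of $ccc\cdots$ for $w$, written $c_{(K_1)}\cdots c_{(K_p)}$ with $p$ minimal, and $w$ is $c$-sortable iff $K_1\supseteq\cdots\supseteq K_p$; $\pi^c_\downarrow(w)$ is the maximal $c$-sortable element below $w$ in right weak order. The $c$-Cambrian fan $\mathcal F_c$ has maximal cones $C(w)=\bigcup_{\pi^c_\downarrow(w')=w}w'(D)$ ($w$ $c$-sortable); its rays $\mathcal F_c^{(1)}$ are rays of $\mathcal F$. For a ray $\rho=w(\rho_s)$, $\mathscr H^{\pmb a}_\rho=\{v:\langle v,w(v_s)\rangle\le\langle\pmb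 a,v_s\rangle\}$. $\mathrm{Perm}^{\pmb a}(W)=\mathrm{conv}\{w(\pmb a):w\in W\}$ and $\mathrm{Ass}^{\pmb a}_c(W)=\bigcap_{\rho\in\mathcal F_c^{(1)}}\mathscr H^{\pmb a}_\rho$. *)

(* Defs.v *)
From HB Require Import structures.
From mathcomp Require Import all_boot all_order all_algebra.
From mathcomp Require Import all_classical all_reals topology normedtype.

Set Implicit Arguments.
Unset Strict Implicit.
Unset Printing Implicit Defensive.

Import Order.TTheory GRing.Theory Num.Theory.
Import numFieldNormedType.Exports.

Local Open Scope classical_set_scope.
Local Open Scope ring_scope.

(* The Euclidean space V is R^n (column vectors) with its standard scalar
   product; linear maps act on the left.  Simple roots form a basis of V, so
   the set S of simple reflections is identified with 'I_n. *)

Definition dot (R : realType) (n : nat) (u v : 'cV[R]_n) : R :=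
  \sum_(i < n) u i 0 * v i 0.

(* The matrix of v |-> v - 2 <v, a> / <a, a> a. *)
Definition reflection (R : realType) (n : nat) (a : 'cV[R]_n) : 'M[R]_n :=
  1%:M - (2 / dot a a) *: (a *m a^T).

(** Root systems *)

Record root_system (R : realType) (n : nat) (Phi : set 'cV[R]_n) : Prop :=
  RootSystem {
    root_finite : finite_set Phi;
    root_neq0 : ~ Phi 0;
    root_line : forall a, Phi a ->
      Phi `&` range (fun k : R => k *: a) = [set a; - a];
    root_reflection : forall a, Phi a -> mulmx (reflection a) @` Phi = Phi
  }.

Definition crystallographic (R : realType) (n : nat) (Phi : set 'cV[R]_n) :=
  forall a b, Phi a -> Phi b ->
    exists k : int, reflection a *m b = b + k%:~R *: a.

Record simple_system (R : realType) (n : nat) (Phi : set 'cV[R]_n)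
    (alpha : 'I_n -> 'cV[R]_n) : Prop := SimpleSystem {
  simple_root : forall s, Phi (alpha s);
  simple_basis : basis_of fullv (codom alpha);
  simple_sign : forall b, Phi b -> exists k : 'I_n -> R,
    b = \sum_(s < n) k s *: alpha s /\
    ((forall s, 0 <= k s) \/ (forall s, k s <= 0))
}.

Definition fundamental_weights (R : realType) (n : nat)
    (alpha v : 'I_n -> 'cV[R]_n) :=
  forall s t, dot (v s) (alpha t) = (s == t)%:R.

Definition root_lattice (R : realType) (n : nat)
    (alpha : 'I_n -> 'cV[R]_n) : set 'cV[R]_n :=
  [set x | exists k : 'I_n -> int, x = \sum_(s < n) alpha s *~ k s].

(** The group W generated by the simple reflections, words and weak order *)

Definition word_prod (R : realType) (n : nat) (alpha : 'I_n -> 'cV[R]_n)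
    (u : seq 'I_n) : 'M[R]_n :=
  \big[mulmx/1%:M]_(s <- u) reflection (alpha s).

Definition Wgroup (R : realType) (n : nat) (alpha : 'I_n -> 'cV[R]_n) :
    set 'M[R]_n :=
  range (word_prod alpha).

Definition reduced_word (R : realType) (n : nat) (alpha : 'I_n -> 'cV[R]_n)
    (w : 'M[R]_n) (u : seq 'I_n) :=
  word_prod alpha u = w /\
  forall u', word_prod alpha u' = w -> (size u <= size u')%N.

(* u is a prefix of w: w = u u' with lengths adding up. *)
Definition right_weak_le (R : realType) (n : nat) (alpha : 'I_n -> 'cV[R]_n)
    (u w : 'M[R]_n) :=
  exists x y : seq 'I_n,
    reduced_word alpha u x /\ reduced_word alpha w (x ++ y).

(** Sortable elements *)

(* A Coxeter element is given by its fixed reduced expression: a word in which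
   every simple reflection occurs exactly once. *)
Definition coxeter_word (n : nat) (c : seq 'I_n) := perm_eq c (enum 'I_n).

Definition restrict_word (n : nat) (c : seq 'I_n) (J : {set 'I_n}) :
    seq 'I_n :=
  [seq s <- c | s \in J].

(* The finite subwords of c c c ... are encoded as K = [:: K_1; ...; K_p]:
   K_i is the set of letters kept in the i-th copy of c. *)
Definition factor_word (n : nat) (c : seq 'I_n) (K : seq {set 'I_n}) :
    seq 'I_n :=
  flatten [seq restrict_word c J | J <- K].

(* The increasing list of the positions in c c c ... that K selects. *)
Definition factor_positions (n : nat) (c : seq 'I_n) (K : seq {set 'I_n}) :
    seq nat :=
  flatten [seq [seq (i * size c + index s c)%N
                 | s <- restrict_word c (nth finset.set0 K i)]
            | i <- iota 0 (size K)].

Definition sorting_word (R : realType) (n : nat) (alpha : 'I_n -> 'cV[R]_n)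
    (c : seq 'I_n) (w : 'M[R]_n) (K : seq {set 'I_n}) :=
  [/\ reduced_word alpha w (factor_word c K),
      (forall K', reduced_word alpha w (factor_word c K') ->
         ((factor_positions c K : seqlexi nat) <= factor_positions c K')%O) &
      (forall K', factor_positions c K' = factor_positions c K ->
         (size K <= size K')%N)].

Definition sortable (R : realType) (n : nat) (alpha : 'I_n -> 'cV[R]_n)
    (c : seq 'I_n) (w : 'M[R]_n) :=
  exists K, sorting_word alpha c w K /\
    sorted (fun J J' : {set 'I_n} => J' \subset J) K.

(* As a relation: u is the projection of w to the c-sortable elements. *)
Definition pi_down (R : realType) (n : nat) (alpha : 'I_n -> 'cV[R]_n)
    (c : seq 'I_n) (w u : 'M[R]_n) :=
  [/\ sortable alpha c u, right_weak_le alpha u w &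
      forall u', sortable alpha c u' -> right_weak_le alpha u' w ->
        right_weak_le alpha u' u].

(** The Cambrian fan *)

Definition fundamental_chamber (R : realType) (n : nat)
    (alpha : 'I_n -> 'cV[R]_n) : set 'cV[R]_n :=
  [set x | forall s, 0 <= dot x (alpha s)].

Definition cambrian_cone (R : realType) (n : nat) (alpha : 'I_n -> 'cV[R]_n)
    (c : seq 'I_n) (w : 'M[R]_n) : set 'cV[R]_n :=
  \bigcup_(w' in [set w' | Wgroup alpha w' /\ pi_down alpha c w' w])
    (mulmx w' @` fundamental_chamber alpha).

Definition cone_face (R : realType) (n : nat) (C F : set 'cV[R]_n) :=
  exists f : 'cV[R]_n, (forall x, C x -> 0 <= dot f x) /\
    F = C `&` [set x | dot f x = 0].

Definition cambrian_fan (R : realType) (n : nat) (alpha : 'I_n -> 'cV[R]_n)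
    (c : seq 'I_n) : set (set 'cV[R]_n) :=
  [set F | exists w, sortable alpha c w /\
                     cone_face (cambrian_cone alpha c w) F].

Definition ray (R : realType) (n : nat) (x : 'cV[R]_n) : set 'cV[R]_n :=
  [set t *: x | t in [set t : R | 0 <= t]].

Definition cambrian_rays (R : realType) (n : nat) (alpha : 'I_n -> 'cV[R]_n)
    (c : seq 'I_n) : set (set 'cV[R]_n) :=
  [set rho | cambrian_fan alpha c rho /\ exists2 x, x != 0 & rho = ray x].

(** The polytopes *)

(* The half-space attached to a ray rho = w(rho_s), where rho_s = ray (v s);
   it does not depend on the choice of (w, s). *)
Definition halfspace (R : realType) (n : nat) (alpha v : 'I_n -> 'cV[R]_n)
    (a : 'cV[R]_n) (rho : set 'cV[R]_n) : set 'cV[R]_n :=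
  [set x | forall w s, Wgroup alpha w -> rho = mulmx w @` ray (v s) ->
             dot x (w *m v s) <= dot a (v s)].

Definition convex_hull (R : realType) (n : nat) (A : set 'cV[R]_n) :
    set 'cV[R]_n :=
  [set x | exists (m : nat) (t : 'I_m -> R) (p : 'I_m -> 'cV[R]_n),
     [/\ forall i, 0 <= t i, \sum_(i < m) t i = 1, forall i, A (p i) &
         x = \sum_(i < m) t i *: p i]].

Definition Perm (R : realType) (n : nat) (alpha : 'I_n -> 'cV[R]_n)
    (a : 'cV[R]_n) : set 'cV[R]_n :=
  convex_hull [set w *m a | w in Wgroup alpha].

Definition Ass (R : realType) (n : nat) (alpha v : 'I_n -> 'cV[R]_n)
    (c : seq 'I_n) (a : 'cV[R]_n) : set 'cV[R]_n :=
  \bigcap_(rho in cambrian_rays alpha c) halfspace alpha v a rho.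

(* Vertices are the zero-dimensional faces: {x} is the set of maximizers on P
   of some linear functional. *)
Definition vertices (R : realType) (n : nat) (P : set 'cV[R]_n) :
    set 'cV[R]_n :=
  [set x | P x /\ exists f : 'cV[R]_n,
     forall y, P y -> y <> x -> dot f y < dot f x].

(* Main.v *)
Require Import Defs.
From HB Require Import structures.
From mathcomp Require Import all_boot all_order all_algebra.
From mathcomp Require Import all_classical all_reals topology normedtype.
From mathcomp Require Import ring lra zify.

Set Implicit Arguments.
Unset Strict Implicit.
Unset Printing Implicit Defensive.

Import Order.TTheory GRing.Theory Num.Theory.
Import numFieldNormedType.Exports.

Local Open Scope classical_set_scope.
Local Open Scope ring_scope.

(* A maximal cone of the Cambrian fan is cut out by a basis B of roots of the
   following kind (Speyer and Thomas): the reflections in the positive members of B,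
   followed by those in the negative ones, multiply in some order to the Coxeter
   element c, and members of B of equal sign meet at obtuse angles.  Such families
   are stable under the two moves by which c-sortable elements are built: deleting
   an initial letter s of c when alpha_s lies in B, and rotating s to the end of c
   (applying s to B) otherwise.  By induction along these moves every regular point
   lies in exactly one cone, the cones are the fibres of the projection to sortable
   elements, and crossing a facet with normal b changes the other roots of B by
   multiples of b.  The bases B consist of lattice vectors, so the point x_B with
   prescribed integral values <x_B, g> = h g on the rays g of the cone is in L.

   It remains to see that the x_B satisfy all the inequalities <x, g> <= h g.  This is
   clear for the linear function h = <a, .>.  If it holds for (c s, h), then it holds
   for s c and the function h' with h'(v_s) = <a, v_s> and h'(g) = h(s g) on the other
   rays: only the ray v_s is new, and along a gallery that starts at the dominant
   chamber the points x_B move by nonpositive multiples of positive roots.  After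
   finitely many rotations every ray has been w v_t for an initial letter t at
   some stage, and h has become the function w v_t |-> <a, v_t>. *)

(** Behind both moves is one identity: if c = s c' then c' fixes v_s, so the product of the family
    sends v_s to s v_s. With the obtuse angles this gives that alpha_s is nonpositive on the cone
    unless alpha_s itself is in B. With linear independence it shows which members of B commute with
    alpha_s or -alpha_s when one of these occurs. The sign of alpha_s on a regular point therefore
    decides which move applies, for cones and for sortable elements alike, and the same induction
    handles both. The obstacle to convexity is that a cone with alpha_s in B is not the image under
    s of a cone for c s. It is compared with its neighbour across the wall alpha_s, which is such an
    image: the vertex moves along alpha_s, and every ray g other than v_s satisfies <g, alpha_s> <=
    0. The vertices of Ass are reached through their functionals: f lies in some cone of the fan,
    x_B maximizes f over Ass, and a unique maximizer must equal x_B. *)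

(** * Scalar products and products of reflections *)

Section Dot.
Variables (R : realType) (n : nat).
Implicit Types x y z b s : 'cV[R]_n.

Lemma dotC x y : dot x y = dot y x.
Proof. by apply: eq_bigr => i _; rewrite mulrC. Qed.

Lemma dotDl x y z : dot (x + y) z = dot x z + dot y z.
Proof. by rewrite /dot -big_split; apply: eq_bigr => i _; rewrite mxE mulrDl. Qed.

Lemma dotZl (k : R) x z : dot (k *: x) z = k * dot x z.
Proof. by rewrite /dot mulr_sumr; apply: eq_bigr => i _; rewrite mxE mulrA. Qed.

Lemma dotNl x z : dot (- x) z = - dot x z.
Proof. by rewrite -scaleN1r dotZl mulN1r. Qed.

Lemma dot0l z : dot 0 z = 0.
Proof. by rewrite -(scale0r 0) dotZl mul0r. Qed.

Lemma dotBl x y z : dot (x - y) z = dot x z - dot y z.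
Proof. by rewrite dotDl dotNl. Qed.

Lemma dotDr z x y : dot z (x + y) = dot z x + dot z y.
Proof. by rewrite !(dotC z) dotDl. Qed.

Lemma dotZr (k : R) z x : dot z (k *: x) = k * dot z x.
Proof. by rewrite !(dotC z) dotZl. Qed.

Lemma dotNr z x : dot z (- x) = - dot z x.
Proof. by rewrite !(dotC z) dotNl. Qed.

Lemma dot0r z : dot z 0 = 0.
Proof. by rewrite dotC dot0l. Qed.

Lemma dotBr z x y : dot z (x - y) = dot z x - dot z y.
Proof. by rewrite !(dotC z) dotBl. Qed.

Definition dotE := (dotBl, dotBr, dotDl, dotDr, dotZl, dotZr, dotNl, dotNr, dot0l, dot0r).

Lemma dot_suml (I : Type) (r : seq I) (P : pred I) (F : I -> 'cV[R]_n) z :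
  dot (\sum_(i <- r | P i) F i) z = \sum_(i <- r | P i) dot (F i) z.
Proof. by apply: (big_morph (fun x => dot x z)) => [x y|]; rewrite ?dotDl ?dot0l. Qed.

Lemma dot_sumr (I : Type) (r : seq I) (P : pred I) (F : I -> 'cV[R]_n) z :
  dot z (\sum_(i <- r | P i) F i) = \sum_(i <- r | P i) dot z (F i).
Proof. by rewrite dotC dot_suml; apply: eq_bigr => i _; rewrite dotC. Qed.

Lemma dot_ge0 x : 0 <= dot x x.
Proof. by apply: sumr_ge0 => i _; rewrite -expr2 sqr_ge0. Qed.

Lemma dot_eq0 x : (dot x x == 0) = (x == 0).
Proof.
apply/eqP/eqP => [|->]; last by rewrite dot0l.
move=> /eqP; rewrite psumr_eq0 => [|i _]; last by rewrite -expr2 sqr_ge0.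
move=> /allP h; apply/matrixP => i j; rewrite mxE ord1; apply/eqP.
by have := h i (mem_index_enum _); rewrite -expr2 sqrf_eq0.
Qed.

Lemma dot_gt0 x : (0 < dot x x) = (x != 0).
Proof. by rewrite lt_def dot_ge0 dot_eq0 andbT. Qed.

Definition rf b z : 'cV[R]_n := z - (2 * dot z b / dot b b) *: b.

Lemma reflectionE b z : reflection b *m z = rf b z.
Proof.
rewrite /reflection mulmxBl mul1mx -scalemxAl -mulmxA; congr (_ - _).
have -> : b^T *m z = (dot z b)%:M.
  by apply/matrixP => i j; rewrite !ord1 !mxE eqxx mulr1n; apply: eq_bigr => k _; rewrite mxE mulrC.
rewrite mul_mx_scalar scalerA; congr (_ *: _); ring.
Qed.

Lemma rfD b y z : rf b (y + z) = rf b y + rf b z.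
Proof. by rewrite -!reflectionE mulmxDr. Qed.

Lemma rfZ b (k : R) z : rf b (k *: z) = k *: rf b z.
Proof. by rewrite -!reflectionE -scalemxAr. Qed.

Lemma rfN b z : rf b (- z) = - rf b z.
Proof. by rewrite -!reflectionE mulmxN. Qed.

Lemma rfB b y z : rf b (y - z) = rf b y - rf b z.
Proof. by rewrite rfD rfN. Qed.

Lemma rf0 b : rf b 0 = 0.
Proof. by rewrite -!reflectionE mulmx0. Qed.

Lemma rf_id b z : dot z b = 0 -> rf b z = z.
Proof. by move=> h; rewrite /rf h mulr0 mul0r scale0r subr0. Qed.

Lemma rfNl b z : rf (- b) z = rf b z.
Proof. by rewrite /rf !dotE opprK scalerN mulrN mulNr scaleNr opprK. Qed.

Lemma rf_self b : rf b b = - b.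
Proof.
have [->|b0] := eqVneq b 0; first by rewrite rf0 oppr0.
rewrite /rf -mulrA divff ?dot_eq0 // mulr1 scaler_nat mulr2n opprD addrA.
by rewrite subrr add0r.
Qed.

Lemma rfK b : involutive (rf b).
Proof.
move=> z; rewrite {2}/rf rfB rfZ rf_self scalerN opprK /rf.
by rewrite subrK.
Qed.

Lemma rf_adj b x y : dot (rf b x) y = dot x (rf b y).
Proof. by rewrite /rf !dotE (dotC b y) (dotC x b) (dotC b x) (dotC y b); ring. Qed.

Lemma rf_iso b x y : dot (rf b x) (rf b y) = dot x y.
Proof. by rewrite rf_adj rfK. Qed.

Lemma rf_conj s b z : rf (rf s b) (rf s z) = rf s (rf b z).
Proof. by rewrite {1}/rf !rf_iso rfB rfZ. Qed.

Lemma rf_inj b : injective (rf b).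
Proof. exact: inv_inj (rfK b). Qed.

Definition rp (B : seq 'cV[R]_n) z := foldr rf z B.

Lemma rp_cat B B' z : rp (B ++ B') z = rp B (rp B' z).
Proof. by rewrite /rp foldr_cat. Qed.

Lemma rp_rcons B b z : rp (rcons B b) z = rp B (rf b z).
Proof. by rewrite -cats1 rp_cat. Qed.

Lemma rp_revK B z : rp (rev B) (rp B z) = z.
Proof. by elim: B => //= b B IH; rewrite rev_cons rp_rcons rfK IH. Qed.

Lemma rpK B z : rp B (rp (rev B) z) = z.
Proof. by rewrite -{1}(revK B) rp_revK. Qed.

Lemma rp_map_rf s B z : rp (map (rf s) B) z = rf s (rp B (rf s z)).
Proof. by elim: B => [|b B IH] /=; rewrite ?rfK // IH rf_conj. Qed.

Lemma rp_mapN B z : rp (map -%R B) z = rp B z.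
Proof. by elim: B => //= b B ->; rewrite rfNl. Qed.

Lemma rpN B z : rp B (- z) = - rp B z.
Proof. by elim: B => //= b B ->; rewrite rfN. Qed.

Lemma rp_id B z : {in B, forall b, dot z b = 0} -> rp B z = z.
Proof.
elim: B => //= b B IH h; rewrite IH => [|b' b'B]; last by apply: h; rewrite inE b'B orbT.
by apply: rf_id; apply: h; rewrite mem_head.
Qed.

(** Each reflection changes a vector by a multiple of its root, so the difference lies in the span
    of B. *)
Lemma rp_span B g z : {in B, forall b, dot g b = 0} -> dot g (z - rp B z) = 0.
Proof.
elim: B => /= [|b B IH] h; first by rewrite subrr dot0r.
have hb : dot g b = 0 by apply: h; rewrite mem_head.
rewrite {1}/rf opprB addrCA dotDr dotZr hb mulr0 add0r.
by apply: IH => b' b'B; apply: h; rewrite inE b'B orbT.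
Qed.

Lemma rp_iso B x y : dot (rp B x) (rp B y) = dot x y.
Proof. by elim: B => //= b B IH; rewrite rf_iso. Qed.

Lemma rp_comm B s z : {in B, forall b, dot b s = 0} -> rp B (rf s z) = rf s (rp B z).
Proof.
move=> h; have E : map (rf s) B = B.
  rewrite -[RHS]map_id; apply/eq_in_map => b bB /=; exact/rf_id/h.
by rewrite -{1}E rp_map_rf rfK.
Qed.

End Dot.

(* The chamber w(D) is represented by its regular point w a. *)
Record root_datum (R : realType) (n : nat) := RootDatum {
  rd_alpha : 'I_n -> 'cV[R]_n;
  rd_v : 'I_n -> 'cV[R]_n;
  rd_a : 'cV[R]_n;
  rd_roots : seq 'cV[R]_n;
  roots_uniq : uniq rd_roots;
  roots_neq0 : 0 \notin rd_roots;
  roots_line : forall b k, b \in rd_roots -> k *: b \in rd_roots -> k = 1 \/ k = -1;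
  roots_rf : forall b b', b \in rd_roots -> b' \in rd_roots -> rf b b' \in rd_roots;
  alpha_root : forall s, rd_alpha s \in rd_roots;
  dot_v_alpha : forall s t, dot (rd_v s) (rd_alpha t) = (s == t)%:R;
  alpha_span : forall z, (forall s, dot z (rd_alpha s) = 0) -> z = 0;
  roots_sign : forall b, b \in rd_roots ->
    (forall s, 0 <= dot (rd_v s) b) \/ (forall s, dot (rd_v s) b <= 0);
  a_dom : forall s, 0 < dot rd_a (rd_alpha s);
  alpha_int : forall s t, exists k : int,
    rf (rd_alpha s) (rd_alpha t) = rd_alpha t + k%:~R *: rd_alpha s
}.

(** * Positive roots, inversions and words in the simple reflections *)

Section Datum.
Variables (R : realType) (n : nat) (d : root_datum R n).
Implicit Types (b y z g : 'cV[R]_n) (s t r : 'I_n).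
Local Notation V := 'cV[R]_n.
Local Notation alpha := (rd_alpha d).
Local Notation v := (rd_v d).
Local Notation a := (rd_a d).
Local Notation roots := (rd_roots d).
Local Notation sf s := (rf (alpha s)).

Lemma expand_alpha z : z = \sum_s dot z (v s) *: alpha s.
Proof.
suff key y : y = \sum_s dot y (alpha s) *: v s.
  set z' := \sum_s _; apply/eqP; rewrite -subr_eq0 -dot_eq0; apply/eqP.
  rewrite {1}(key (z - z')) dot_suml big1 // => s _; rewrite dotZl.
  suff -> : dot (v s) (z - z') = 0 by rewrite mulr0.
  rewrite dotBr /z' dot_sumr (bigD1 s) //= big1 => [|t ts].
    by rewrite dotZr dot_v_alpha eqxx mulr1 addr0 dotC subrr.
  by rewrite dotZr dot_v_alpha eq_sym (negPf ts) mulr0.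
apply/eqP; rewrite -subr_eq0; apply/eqP/(@alpha_span _ _ d) => t.
rewrite dotBl dot_suml (bigD1 t) //= big1 => [|s st].
  by rewrite dotZl dot_v_alpha eqxx mulr1 addr0 subrr.
by rewrite dotZl dot_v_alpha (negPf st) mulr0.
Qed.

Lemma dot_expand y z : dot y z = \sum_s dot z (v s) * dot y (alpha s).
Proof. by rewrite {1}(expand_alpha z) dot_sumr; apply: eq_bigr => s _; rewrite dotZr. Qed.

Lemma root_nonzero b : b \in roots -> b != 0.
Proof. by apply: contraTneq => ->; exact: roots_neq0. Qed.

Lemma root_dot_gt0 b : b \in roots -> 0 < dot b b.
Proof. by move=> /root_nonzero; rewrite dot_gt0. Qed.

Lemma rootN b : b \in roots -> - b \in roots.
Proof. by move=> bR; rewrite -rf_self roots_rf. Qed.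

Lemma rootNE b : (- b \in roots) = (b \in roots).
Proof. by apply/idP/idP => /rootN; rewrite ?opprK. Qed.

Lemma sf_root s b : (sf s b \in roots) = (b \in roots).
Proof.
by apply/idP/idP => /(roots_rf (alpha_root d s)); rewrite ?rfK.
Qed.

Lemma sf_alpha s : sf s (alpha s) = - alpha s.
Proof. exact: rf_self. Qed.

Lemma sf_v s t : t != s -> sf s (v t) = v t.
Proof. by move=> ts; rewrite rf_id // dot_v_alpha (negPf ts). Qed.

Lemma alpha_dot_gt0 s : 0 < dot (alpha s) (alpha s).
Proof. exact/root_dot_gt0/alpha_root. Qed.

Lemma root_pos_coef b s : b \in roots -> 0 < dot a b -> 0 <= dot (v s) b.
Proof.
move=> bR; case: (roots_sign bR) => // h; rewrite ltNge dot_expand sumr_le0 // => t _.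
by apply: mulr_le0_ge0; rewrite ?(ltW (a_dom _ _)) // dotC.
Qed.

Lemma root_neg_coef b s : b \in roots -> dot a b < 0 -> dot (v s) b <= 0.
Proof.
move=> bR h; rewrite -oppr_ge0 -dotNr root_pos_coef ?rootN //.
by rewrite dotNr oppr_gt0.
Qed.

Lemma coef_pos b t : b \in roots -> 0 < dot (v t) b -> 0 < dot a b.
Proof.
move=> bR ht; case: (roots_sign bR) => [h|/(_ t)]; last by rewrite leNgt ht.
rewrite dot_expand (bigD1 t) //= ltr_pwDl ?mulr_gt0 ?a_dom // ?(dotC b) //.
by apply: sumr_ge0 => s _; rewrite mulr_ge0 ?(ltW (a_dom _ _)) // dotC.
Qed.

Lemma root_regular b : b \in roots -> dot a b != 0.
Proof.
move=> bR; apply/eqP => h0.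
have [s hs] : exists s, dot (v s) b != 0.
  apply/existsP; rewrite -[X in is_true X]negbK negb_exists; apply/negP => /forallP h.
  have := root_nonzero bR; rewrite (expand_alpha b) big1 ?eqxx // => s _.
  by move: (h s); rewrite negbK dotC => /eqP ->; rewrite scale0r.
have [hp|hn] : 0 < dot (v s) b \/ 0 < dot (v s) (- b).
  by case: (ltgtP (dot (v s) b) 0) hs => // h _; [right|left] => //; rewrite dotNr oppr_gt0.
- by have := coef_pos bR hp; rewrite h0 ltxx.
- by have := coef_pos (rootN bR) hn; rewrite dotNr h0 oppr0 ltxx.
Qed.

Lemma root_posN b : b \in roots -> (dot a b < 0) = ~~ (0 < dot a b).
Proof. by move=> /root_regular h; rewrite -leNgt le_eqVlt (negPf h). Qed.

Lemma coef_sf s b t : t != s -> dot (v t) (sf s b) = dot (v t) b.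
Proof. by move=> ts; rewrite -rf_adj sf_v. Qed.

(** Otherwise b would be a multiple of [alpha s], and the only such roots are [alpha s] and its
    negative. The coefficient found here survives [sf s], which changes only the coordinate at s;
    this gives [sf_pos]. *)
Lemma root_other_coef s b : b \in roots -> 0 < dot a b -> b != alpha s ->
  exists2 t, t != s & 0 < dot (v t) b.
Proof.
move=> bR bp bs; case: (pselect (exists2 t, t != s & 0 < dot (v t) b)) => // hn.
have h t : t != s -> dot (v t) b = 0.
  move=> ts; apply/eqP; rewrite eq_le root_pos_coef // andbT leNgt.
  by apply/negP => ht; apply: hn; exists t.
have E : b = dot b (v s) *: alpha s.
  rewrite {1}(expand_alpha b) (bigD1 s) //= big1 ?addr0 // => t ts.
  by rewrite dotC h // scale0r.
have := bR; rewrite E => /(roots_line (alpha_root d s)) [k1|k1].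
  by case/eqP: bs; rewrite E k1 scale1r.
by have := root_pos_coef s bR bp; rewrite dotC k1 ler0N1.
Qed.

Lemma sf_pos s b : b \in roots -> 0 < dot a b -> b != alpha s -> 0 < dot a (sf s b).
Proof.
move=> bR bp bs; have [t ts ht] := root_other_coef bR bp bs.
by apply: (@coef_pos _ t); rewrite ?sf_root // coef_sf.
Qed.

Lemma sf_neg s b : b \in roots -> dot a b < 0 -> b != - alpha s -> dot a (sf s b) < 0.
Proof.
move=> bR bn bs; rewrite -oppr_gt0 -dotNr -rfN sf_pos ?rootN //.
  by rewrite dotNr oppr_gt0.
by rewrite -(inj_eq oppr_inj) opprK.
Qed.

Lemma alpha_pos s : 0 < dot a (alpha s).
Proof. exact: a_dom. Qed.

Lemma alpha_inj : injective alpha.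
Proof.
move=> s t /(congr1 (dot (v s))); rewrite !dot_v_alpha eqxx.
by case: eqP => // _ /eqP; rewrite oner_eq0.
Qed.

Lemma dot_alpha_le0 s t : s != t -> dot (alpha s) (alpha t) <= 0.
Proof.
move=> st; have hp := sf_pos (alpha_root d s) (alpha_pos s).
have /hp {}hp : alpha s != alpha t by rewrite (inj_eq alpha_inj).
have := root_pos_coef t _ hp; rewrite sf_root alpha_root => /(_ isT).
rewrite /rf dotBr dotZr !dot_v_alpha eqxx eq_sym (negPf st) mulr1 sub0r oppr_ge0.
by rewrite pmulr_lle0 ?invr_gt0 ?alpha_dot_gt0 // pmulr_rle0.
Qed.

Lemma pos_dot_alpha_le0 b s : b \in roots -> 0 < dot a b -> dot (v s) b = 0 ->
  dot b (alpha s) <= 0.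
Proof.
move=> bR bp b0; rewrite dotC dot_expand (bigD1 s) //= dotC b0 mul0r add0r.
apply: sumr_le0 => t ts; apply: mulr_ge0_le0; first by rewrite dotC root_pos_coef.
by rewrite dot_alpha_le0 // eq_sym.
Qed.

Definition pcount (N : pred V) := count (fun b => (0 < dot a b) && N b) roots.

(** [sf s] permutes the positive roots other than [alpha s], so only [alpha s] can change the count.
    The predicate is arbitrary because [chamber_near] counts signs of a pair of vectors. *)
Lemma pcount_sf s (N : pred V) :
  (pcount (fun b => N (sf s b)) + N (alpha s) = pcount N + N (- alpha s))%N.
Proof.
pose Q := [seq b <- roots | (0 < dot a b) && (b != alpha s)].
have E (M : pred V) : pcount M = (M (alpha s) + count M Q)%N.
  rewrite /pcount (permP (perm_to_rem (alpha_root d s))) /= alpha_pos.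
  rewrite rem_filter ?roots_uniq // /Q !count_filter; congr (_ + _)%N.
  by apply: eq_count => b /=; case: (M b); rewrite ?andbT ?andbF.
rewrite !E sf_alpha.
have /permP P : perm_eq (map (sf s) Q) Q.
  have uQ : uniq Q by rewrite filter_uniq ?roots_uniq.
  apply: uniq_perm => //; first by rewrite map_inj_uniq //; exact: rf_inj.
  have sub b : b \in Q -> sf s b \in Q.
    rewrite !mem_filter => /andP[/andP[bp bs] bR]; rewrite sf_root bR sf_pos // andbT /=.
    apply: contraTneq bp => /(congr1 (sf s)); rewrite rfK sf_alpha => ->.
    by rewrite dotNr oppr_gt0 -leNgt ltW ?alpha_pos.
  move=> b; apply/idP/idP => [/mapP[b' b'Q ->]|bQ]; first exact: sub.
  by apply/mapP; exists (sf s b); rewrite ?rfK // sub.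
have -> : count (fun b => N (sf s b)) Q = count N Q by rewrite -(P N) count_map.
lia.
Qed.

(** For y = w a this is the length of w; for rays it serves as a termination measure. *)
Definition ninv y := pcount (fun b => dot y b < 0).

Definition regular y := forall b, b \in roots -> dot y b != 0.

Lemma ninv_sf s y :
  (ninv (sf s y) + (dot y (alpha s) < 0)%R = ninv y + (0 < dot y (alpha s))%R)%N.
Proof.
have := pcount_sf s (fun b => dot y b < 0); rewrite dotNr oppr_lt0 => <-.
by congr (_ + _)%N; apply: eq_count => b /=; rewrite rf_adj.
Qed.

Lemma ninv_desc s y : dot y (alpha s) < 0 -> ninv y = (ninv (sf s y)).+1.
Proof.
move=> h; have := ninv_sf s y; rewrite h [0 < _]lt_gtF // addn0 addn1.
by move=> <-.
Qed.

Lemma ninv_asc s y : 0 < dot y (alpha s) -> ninv (sf s y) = (ninv y).+1.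
Proof.
move=> h; have := ninv_sf s y; rewrite h [_ < 0]lt_gtF // addn0 addn1.
by move=> ->.
Qed.

Lemma regular_sf s y : regular y -> regular (sf s y).
Proof. by move=> h b bR; rewrite rf_adj h // sf_root. Qed.

Lemma regular_a : regular a.
Proof. exact: root_regular. Qed.

Lemma regular_neg y b : regular y -> b \in roots -> (dot y b < 0) = ~~ (0 < dot y b).
Proof. by move=> h /h hb; rewrite -leNgt le_eqVlt (negPf hb). Qed.

Definition ap (x : seq 'I_n) z := rp (map alpha x) z.

Lemma apE x z : word_prod alpha x *m z = ap x z.
Proof.
rewrite /word_prod /ap; elim: x => [|s x IH]; first by rewrite big_nil mul1mx.
by rewrite big_cons /= -mulmxA IH reflectionE.
Qed.

Lemma ap_cat x x' z : ap (x ++ x') z = ap x (ap x' z).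
Proof. by rewrite /ap map_cat rp_cat. Qed.

Lemma ap_rcons x s z : ap (rcons x s) z = ap x (sf s z).
Proof. by rewrite -cats1 ap_cat. Qed.

Lemma ap_cons s x z : ap (s :: x) z = sf s (ap x z).
Proof. by []. Qed.

Lemma ap_v x s : s \notin x -> ap x (v s) = v s.
Proof.
by elim: x => //= r x IH; rewrite inE negb_or => /andP[sr sx]; rewrite ap_cons IH // sf_v.
Qed.

Lemma ap_root x b : (ap x b \in roots) = (b \in roots).
Proof. by elim: x => //= s x IH; rewrite ap_cons sf_root. Qed.

Lemma ap_iso x y z : dot (ap x y) (ap x z) = dot y z.
Proof. exact: rp_iso. Qed.

Lemma ap_revK x z : ap (rev x) (ap x z) = z.
Proof. by rewrite /ap map_rev rp_revK. Qed.

Lemma apK x z : ap x (ap (rev x) z) = z.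
Proof. by rewrite /ap map_rev rpK. Qed.

Lemma ap_adj x y z : dot (ap x y) z = dot y (ap (rev x) z).
Proof. by rewrite -(ap_iso (rev x)) ap_revK. Qed.

Lemma regular_ap x y : regular y -> regular (ap x y).
Proof. by elim: x => //= s x IH h; apply: regular_sf; apply: IH. Qed.

Lemma regular_apa x : regular (ap x a).
Proof. exact/regular_ap/regular_a. Qed.

End Datum.

(** * Families of roots attached to a Coxeter word *)

Section CambrianFamilies.
Variables (R : realType) (n : nat) (d : root_datum R n).
Local Notation V := 'cV[R]_n.
Local Notation alpha := (rd_alpha d).
Local Notation v := (rd_v d).
Local Notation a := (rd_a d).
Local Notation roots := (rd_roots d).
Local Notation sf s := (rf (alpha s)).
Implicit Types (b y z g : V) (s t r : 'I_n) (c : seq 'I_n) (B P N : seq V).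

Definition cone B z := {in B, forall b, 0 <= dot z b}.
Definition icone B z := {in B, forall b, 0 < dot z b}.
(** For a positive root g this will mean that g is an inversion of the sortable element of the
    cone. *)
Definition neg_on B g := forall z, cone B z -> dot z g <= 0.
Definition dual_vector B b g :=
  dot g b = 1 /\ {in B, forall b', b' != b -> dot g b' = 0}.
Definition obtuse B := {in B &, forall b b', b != b' -> dot b b' <= 0}.

(* The word c need not contain all letters: a family for c then spans the roots of the
   parabolic subgroup of c, inside the same space.  Linear independence is cam_dual. *)
Record cambrian c P N : Prop := Cambrian {
  cam_root : {subset P ++ N <= roots};
  cam_pos : {in P, forall b, 0 < dot a b};
  cam_neg : {in N, forall b, dot a b < 0};
  cam_uniq : uniq (P ++ N);
  cam_supp : {in P ++ N, forall b r, r \notin c -> dot (v r) b = 0};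
  cam_prod : forall z, rp (P ++ N) z = ap d c z;
  cam_obtP : obtuse P;
  cam_obtN : obtuse N;
  cam_dual : {in P ++ N, forall b, exists g, dual_vector (P ++ N) b g};
  cam_span : forall z, {in P ++ N, forall b, dot z b = 0} ->
               {in c, forall r, dot z (alpha r) = 0}
}.

Lemma mem_map_rf s B b : (b \in map (sf s) B) = (sf s b \in B).
Proof. by rewrite -{1}(rfK (alpha s) b) (mem_map (@rf_inj _ _ _)). Qed.

Lemma obtuse_sub B B' : {subset B <= B'} -> obtuse B' -> obtuse B.
Proof. by move=> sub h b b' /sub bB /sub b'B; exact: h. Qed.

Lemma obtuse_map s B : obtuse B -> obtuse (map (sf s) B).
Proof.
move=> h _ _ /mapP[b bB ->] /mapP[b' b'B ->]; rewrite (inj_eq (@rf_inj _ _ _)) rf_iso.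
exact: h.
Qed.

Lemma obtuse_opp B : obtuse B -> obtuse (map -%R B).
Proof.
move=> h _ _ /mapP[b bB ->] /mapP[b' b'B ->]; rewrite (inj_eq oppr_inj) dotNl dotNr opprK.
exact: h.
Qed.

Lemma obtuse_cons b B : {in B, forall b', dot b b' <= 0} -> obtuse B -> obtuse (b :: B).
Proof.
move=> hb hB x y; rewrite !inE => /orP[/eqP->|xB] /orP[/eqP->|yB]; rewrite ?eqxx //.
- by move=> _; exact: hb.
- by move=> _; rewrite dotC; exact: hb.
- exact: hB.
Qed.

Lemma dual_vector_sub B B' b g : {subset B <= B'} -> dual_vector B' b g -> dual_vector B b g.
Proof. by move=> sub [h1 h2]; split=> // b' /sub; exact: h2. Qed.

Lemma dual_vector_map s B b g : dual_vector B b g ->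
  dual_vector (map (sf s) B) (sf s b) (sf s g).
Proof.
move=> [h1 h2]; split; first by rewrite rf_iso.
by move=> _ /mapP[b' b'B ->]; rewrite (inj_eq (@rf_inj _ _ _)) rf_iso; exact: h2.
Qed.

Lemma cone_map s B z : cone (map (sf s) B) z <-> cone B (sf s z).
Proof.
split=> [h b bB|h _ /mapP[b bB ->]]; first by rewrite rf_adj h // map_f.
by rewrite -rf_adj h.
Qed.

Lemma icone_map s B z : icone (map (sf s) B) z <-> icone B (sf s z).
Proof.
split=> [h b bB|h _ /mapP[b bB ->]]; first by rewrite rf_adj h // map_f.
by rewrite -rf_adj h.
Qed.

Lemma neg_on_map s B g : neg_on (map (sf s) B) (sf s g) <-> neg_on B g.
Proof.
split=> h z hz; last by rewrite -rf_adj; apply/h/cone_map.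
by rewrite -(rf_iso (alpha s)); apply/h/cone_map; rewrite rfK.
Qed.

Lemma cone_eq B B' z : B =i B' -> cone B z -> cone B' z.
Proof. by move=> e h b; rewrite -e; exact: h. Qed.

Lemma icone_eq B B' z : B =i B' -> icone B z -> icone B' z.
Proof. by move=> e h b; rewrite -e; exact: h. Qed.

Lemma neg_on_eq B B' g : B =i B' -> neg_on B g -> neg_on B' g.
Proof. by move=> e h z hz; apply/h/(cone_eq _ hz) => b; rewrite e. Qed.

Lemma icone_cone B z : icone B z -> cone B z.
Proof. by move=> h b /h /ltW. Qed.

Lemma dual_vector_eq B B' b g : B =i B' -> dual_vector B b g -> dual_vector B' b g.
Proof. by move=> e; apply: dual_vector_sub => x; rewrite e. Qed.

(* In an obtuse family, successive reflections of a vector that is nonpositive on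
   the family only ever subtract nonpositive multiples of its members. *)
Lemma rp_obtuse_le0 B y z : uniq B -> obtuse B -> {in B, forall b, dot y b <= 0} ->
  cone B z -> dot z (y - rp B y) <= 0.
Proof.
elim: B z => [|b B IH] z /=; first by rewrite subrr dot0r.
move=> /andP[bB uB] oB hy hz.
have {}IH z' : cone B z' -> dot z' (y - rp B y) <= 0.
  apply: IH => //; first by apply: obtuse_sub oB => x xB; rewrite inE xB orbT.
  by move=> x xB; apply: hy; rewrite inE xB orbT.
set t := rp B y in IH *.
have tb : dot t b <= 0.
  (* The test vector -b lies in the cone of the remaining members because they meet b at obtuse
     angles; for this z is kept general in the induction. *)
  have : dot (- b) (y - t) <= 0.
    apply: IH => x xB; rewrite dotNl oppr_ge0 oB ?inE ?eqxx ?xB ?orbT //.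
    by apply: contraNneq bB => ->.
  have := hy b (mem_head _ _); rewrite dotNl dotBr !(dotC b); lra.
rewrite {1}/rf opprB addrCA dotDr dotZr.
have h1 : dot z (y - t) <= 0 by apply: IH => x xB; apply: hz; rewrite inE xB orbT.
rewrite -[0]addr0 lerD //; apply: mulr_le0_ge0; last by apply: hz; rewrite mem_head.
by apply: mulr_le0_ge0; rewrite ?invr_ge0 ?dot_ge0 // pmulr_rle0.
Qed.

Lemma v_sub_sf s : v s - sf s (v s) = (2 / dot (alpha s) (alpha s)) *: alpha s.
Proof. by rewrite /rf opprB addrCA subrr addr0 dot_v_alpha eqxx mulr1. Qed.

(** The product of the family sends [v s] to [sf s (v s)], through the intermediate vector t between
    N and P. On N the vector [v s] is nonpositive; on P so is [- sf s (v s)], as [sf s] keeps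
    positive roots other than [alpha s] positive. The two bounds of [rp_obtuse_le0] add up to a
    bound on a positive multiple of [alpha s]. *)
Lemma neg_on_initial c s P N : s \notin c -> cambrian (s :: c) P N -> alpha s \notin P ->
  neg_on (P ++ N) (alpha s).
Proof.
move=> sc C sP z hz; pose t := rp N (v s).
have pt : rp P t = sf s (v s) by rewrite /t -rp_cat (cam_prod C) ap_cons ap_v.
have h1 : dot z (v s - t) <= 0.
  apply: rp_obtuse_le0; [| exact: cam_obtN C | |].
  - by have := cam_uniq C; rewrite cat_uniq => /and3P[].
  - move=> b bN; apply: root_neg_coef; last exact: (cam_neg C).
    by apply: (cam_root C); rewrite mem_cat bN orbT.
  - by move=> b bN; apply: hz; rewrite mem_cat bN orbT.
have h2 : dot z (- sf s (v s) - rp (rev P) (- sf s (v s))) <= 0.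
  apply: rp_obtuse_le0.
  - by rewrite rev_uniq; have := cam_uniq C; rewrite cat_uniq => /and3P[].
  - by apply: obtuse_sub (cam_obtP C) => b; rewrite mem_rev.
  - move=> b; rewrite mem_rev => bP; rewrite dotNl oppr_le0 rf_adj.
    have bR : b \in roots by apply: (cam_root C); rewrite mem_cat bP.
    apply: root_pos_coef; rewrite ?sf_root // sf_pos // ?(cam_pos C) //.
    by apply: contraNneq sP => <-.
  - by move=> b; rewrite mem_rev => bP; apply: hz; rewrite mem_cat bP.
have : dot z (v s - sf s (v s)) <= 0.
  move: h2; rewrite rpN opprK -pt rp_revK; move: h1; rewrite pt !dotE; lra.
rewrite v_sub_sf dotZr pmulr_rle0 // divr_gt0 // alpha_dot_gt0 //.
Qed.

(** The coordinates of y - rp B y in the independent family B can be read off one after another: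
    once the tail is known to fix y, the coefficient of the first member is a positive multiple of
    its scalar product with y. *)
Lemma rp_fixed B y : uniq B ->
  {in B, forall b, exists2 g, dual_vector B b g & dot g (y - rp B y) = 0} ->
  {in B, forall b, dot y b = 0}.
Proof.
elim: B => //= b B IH /andP[bB uB] h.
have E : y - rf b (rp B y) = (y - rp B y) + (2 * dot (rp B y) b / dot b b) *: b.
  by rewrite {1}/rf opprB addrA addrAC.
have {}IH : {in B, forall b', dot y b' = 0}.
  apply: IH => // b' b'B; have [|g [g1 g2] g3] := h b'; first by rewrite inE b'B orbT.
  have bb' : b != b' by apply: contraNneq bB => ->.
  exists g; first by split=> // x xB; apply: g2; rewrite inE xB orbT.
  by move: g3; rewrite E dotDr dotZr (g2 _ (mem_head _ _) bb') mulr0 addr0.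
have [g [g1 _]] := h b (mem_head _ _); rewrite E rp_id // subrr add0r dotZr g1 mulr1 => h0.
move=> x; rewrite inE => /orP[/eqP->|/IH //].
have [->|b0] := eqVneq b 0; first by rewrite dot0r.
move/eqP: h0; rewrite !mulf_eq0 pnatr_eq0 /= invr_eq0 dot_eq0 (negPf b0) orbF.
by move/eqP.
Qed.

(* C v_s = s v_s for the product C of the family, and the coordinates of v_s - C v_s
   with respect to the family are unique. *)
Lemma split_initial c s B1 b B2 : s \notin c -> uniq (B1 ++ b :: B2) ->
  {in B1 ++ b :: B2, forall x, exists g, dual_vector (B1 ++ b :: B2) x g} ->
  (forall z, rp (B1 ++ b :: B2) z = ap d (s :: c) z) -> b = alpha s \/ b = - alpha s ->
  {in B2, forall x, dot (v s) x = 0} /\ {in B1, forall x, dot (v s) (sf s x) = 0}.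
Proof.
move=> sc; rewrite cat_uniq /= => /and3P[u1 d12 /andP[bB2 u2]] hd hp hb.
have rb z : rf b z = sf s z by case: hb => ->; rewrite ?rfNl.
have hv : rp (B1 ++ b :: B2) (v s) = sf s (v s) by rewrite hp ap_cons ap_v.
move: hv; rewrite rp_cat /= rb; set t := rp B2 (v s) => hv.
have hB2 : {in B2, forall x, dot (v s) x = 0}.
  apply: rp_fixed => // x xB2.
  have [|g [g1 g2]] := hd x; first by rewrite mem_cat inE xB2 !orbT.
  have gb : dot g (alpha s) = 0.
    have : dot g b = 0.
      apply: g2; first by rewrite mem_cat mem_head orbT.
      by apply: contraNneq bB2 => ->.
    by case: hb => ->; rewrite ?dotNr // => /eqP; rewrite oppr_eq0 => /eqP.
  have gB1 : {in B1, forall y, dot g y = 0}.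
    move=> y yB1; apply: g2; first by rewrite mem_cat yB1.
    apply: contraNneq d12 => e; apply/orP; right; apply/hasP; exists x => //.
    by rewrite -e.
  exists g; first by split=> // y yB2; apply: g2; rewrite mem_cat inE yB2 !orbT.
  (* Since g is orthogonal to B1 and to [alpha s], pairing with it leaves only the contribution of
     B2. *)
  have h1 := rp_span (sf s t) gB1.
  have h2 : dot g (v s - sf s (v s)) = 0 by rewrite v_sub_sf dotZr gb mulr0.
  have h3 : dot g (sf s t) = dot g t by rewrite {1}/rf dotBr dotZr gb mulr0 subr0.
  move: h1 h2; rewrite hv (dotBr g (sf s t)) h3 (dotBr g (v s)) (dotBr g (v s)) -/t; lra.
split=> // x xB1; rewrite -rf_adj.
have tE : t = v s by apply: rp_id.
rewrite tE in hv.
move: x xB1; apply: rp_fixed => // x xB1.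
have [|g gP] := hd x; first by rewrite mem_cat xB1.
exists g; last by rewrite hv subrr dot0r.
by apply: dual_vector_sub gP => y yB1; rewrite mem_cat yB1.
Qed.

Lemma mem_cat_cons (T : eqType) (B1 B2 : seq T) (b : T) :
  B1 ++ b :: B2 =i b :: (B1 ++ B2).
Proof. by move=> x; rewrite !(inE, mem_cat) orbCA. Qed.

Lemma coef_alpha_le0 s b : dot (v s) (sf s b) = 0 -> 0 <= dot (v s) b ->
  0 <= dot b (alpha s).
Proof.
rewrite /rf dotBr dotZr dot_v_alpha eqxx mulr1 => /eqP; rewrite subr_eq0 => /eqP ->.
by rewrite pmulr_lge0 ?invr_gt0 ?alpha_dot_gt0 // pmulr_rge0.
Qed.

Lemma coef_alpha0 s b : dot (v s) (sf s b) = 0 -> dot b (alpha s) = 0 -> dot (v s) b = 0.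
Proof. by move=> + h; rewrite rf_id. Qed.

(** A member preceding [alpha s] has nonnegative scalar product with it by [split_initial] and
    nonpositive by obtuseness. Hence the two are orthogonal, and [alpha s] can be moved to the front
    of the product and cancelled. The remaining members have no coordinate at s, as a family for c
    requires. *)
Lemma cambrian_peel c s P N : s \notin c -> cambrian (s :: c) P N -> alpha s \in P ->
  exists2 P1, cambrian c P1 N & P ++ N =i alpha s :: (P1 ++ N).
Proof.
move=> sc C sP; case/splitPr: sP C => P1 P2 C.
have B12 : (P1 ++ alpha s :: P2) ++ N = P1 ++ alpha s :: (P2 ++ N) by rewrite -catA.
have := @split_initial c s P1 (alpha s) (P2 ++ N) sc.
rewrite -B12 => /(_ (cam_uniq C) (cam_dual C) (cam_prod C) (or_introl erefl)) [h2 h1].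
have uP := cam_uniq C; rewrite B12 in uP.
have sP1 : alpha s \notin P1.
  by move: uP; rewrite cat_uniq => /and3P[_ /hasPn h _]; apply: h; rewrite mem_head.
have mem1 b : b \in P1 -> b \in P1 ++ alpha s :: P2 by rewrite mem_cat => ->.
have cm : {in P1, forall b, dot b (alpha s) = 0}.
  move=> b bP1; apply/eqP; rewrite eq_le; apply/andP; split.
    apply: (cam_obtP C); [exact: mem1|by rewrite mem_cat mem_head orbT|].
    by apply: contraNneq sP1 => <-.
  apply: coef_alpha_le0; first exact: h1.
  apply: root_pos_coef; last exact/(cam_pos C)/mem1.
  by apply: (cam_root C); rewrite mem_cat (mem1 _ bP1).
have eqm : (P1 ++ alpha s :: P2) ++ N =i alpha s :: ((P1 ++ P2) ++ N).
  by rewrite B12 -catA; exact: mem_cat_cons.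
have sub : {subset (P1 ++ P2) ++ N <= (P1 ++ alpha s :: P2) ++ N}.
  by move=> b bB; rewrite eqm inE bB orbT.
have subP : {subset P1 ++ P2 <= P1 ++ alpha s :: P2}.
  by move=> b bB; rewrite mem_cat_cons inE bB orbT.
have co : {in (P1 ++ P2) ++ N, forall b, dot (v s) b = 0}.
  move=> b; rewrite -catA mem_cat => /orP[bP1|]; last exact: h2.
  by apply: coef_alpha0; [exact: h1|exact: cm].
exists (P1 ++ P2) => //; split.
- by move=> b /sub /(cam_root C).
- by move=> b /subP /(cam_pos C).
- exact: (cam_neg C).
- by move: uP; rewrite -(cat1s (alpha s)) uniq_catCA /= catA => /andP[].
- move=> b bB r rc; have [->|rs] := eqVneq r s; first exact: co.
  by apply: (cam_supp C) (sub _ bB) _ _; rewrite inE negb_or rs.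
- move=> z; apply: (@rf_inj _ _ (alpha s)); rewrite -ap_cons -(cam_prod C) B12.
  by rewrite -catA !rp_cat /= rp_comm // rp_cat.
- exact: obtuse_sub subP (cam_obtP C).
- exact: (cam_obtN C).
- move=> b /sub /(cam_dual C) [g gP]; exists g; exact: dual_vector_sub gP.
- move=> z hz r rc; have rs : r != s by apply: contraNneq sc => <-.
  (* Subtracting this multiple of [v s] makes the vector orthogonal to [alpha s] as well and keeps
     its products with the other simple roots. *)
  have := cam_span C (z := z - dot z (alpha s) *: v s) _ (x := r).
  rewrite inE rc orbT dotBl dotZl dot_v_alpha eq_sym (negPf rs) mulr0 subr0.
  apply => // b; rewrite eqm inE => /orP[/eqP->|bB]; rewrite dotBl dotZl.
    by rewrite dot_v_alpha eqxx mulr1 subrr.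
  by rewrite co // mulr0 hz // subr0.
Qed.

Lemma cambrian_unpeel c s P N : s \notin c -> cambrian c P N -> cambrian (s :: c) (alpha s :: P) N.
Proof.
move=> sc C; have co : {in P ++ N, forall b, dot (v s) b = 0}.
  by move=> b bB; apply: (cam_supp C).
have v1 : dot (v s) (alpha s) = 1 by rewrite dot_v_alpha eqxx.
split=> /=.
- by move=> b; rewrite inE => /orP[/eqP->|/(cam_root C) //]; exact: alpha_root.
- by move=> b; rewrite inE => /orP[/eqP->|/(cam_pos C) //]; exact: alpha_pos.
- exact: (cam_neg C).
- rewrite (cam_uniq C) andbT; apply/negP => /co /eqP; by rewrite v1 oner_eq0.
- move=> b; rewrite inE => /orP[/eqP->|bB] r; rewrite inE negb_or => /andP[rs rc].
    by rewrite dot_v_alpha (negPf rs).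
  exact: (cam_supp C).
- by move=> z; rewrite (cam_prod C).
- apply: obtuse_cons; last exact: (cam_obtP C).
  move=> b bP; rewrite dotC; have bB : b \in P ++ N by rewrite mem_cat bP.
  by apply: pos_dot_alpha_le0; [exact: (cam_root C)|exact: (cam_pos C)|exact: co].
- exact: (cam_obtN C).
- move=> b; rewrite inE => /orP[/eqP->|bB].
    exists (v s); split=> // b'; rewrite inE => /orP[->//|b'B] _; exact: co.
  have [g [g1 g2]] := cam_dual C bB; exists (g - dot g (alpha s) *: v s); split.
    by rewrite dotBl dotZl co // mulr0 subr0.
  move=> b'; rewrite inE => /orP[/eqP->|b'B] ne; rewrite dotBl dotZl.
    by rewrite v1 mulr1 subrr.
  by rewrite co // mulr0 subr0 g2.
- move=> z hz r; rewrite inE => /orP[/eqP->|rc]; first by apply: hz; rewrite mem_head.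
  by apply: (cam_span C) rc => b bB; apply: hz; rewrite inE bB orbT.
Qed.

(** Reversal inverts the product and negation exchanges the signs. This symmetry turns
    [cambrian_rot] into its converse [cambrian_unrot]. *)
Lemma cambrian_rev c P N : cambrian c P N ->
  cambrian (rev c) (map -%R (rev N)) (map -%R (rev P)).
Proof.
move=> C.
have E : map -%R (rev N) ++ map -%R (rev P) = map -%R (rev (P ++ N)) :> seq V.
  by rewrite rev_cat map_cat.
have memN b (B : seq V) : (b \in map -%R B) = (- b \in B).
  by rewrite -{1}(opprK b) (mem_map oppr_inj).
split; rewrite ?E.
- by move=> b; rewrite memN mem_rev => /(cam_root C); rewrite rootNE.
- by move=> b; rewrite memN mem_rev => /(cam_neg C); rewrite dotNr oppr_lt0.
- by move=> b; rewrite memN mem_rev => /(cam_pos C); rewrite dotNr oppr_gt0.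
- by rewrite (map_inj_uniq oppr_inj) rev_uniq (cam_uniq C).
- move=> b; rewrite memN mem_rev => bB r; rewrite mem_rev => /(cam_supp C bB).
  by rewrite dotNr => /eqP; rewrite oppr_eq0 => /eqP.
- move=> z; rewrite rp_mapN /ap map_rev -[in LHS](rpK (map alpha c) z).
  by rewrite -[rp (map alpha c) _](cam_prod C) rp_revK.
- by apply/obtuse_opp/obtuse_sub/(cam_obtN C) => b; rewrite mem_rev.
- by apply/obtuse_opp/obtuse_sub/(cam_obtP C) => b; rewrite mem_rev.
- move=> b; rewrite memN mem_rev => /(cam_dual C) [g [g1 g2]].
  exists (- g); split; first by rewrite -g1 !dotE.
  move=> b'; rewrite memN mem_rev => /g2 + ne; rewrite (inj_eq oppr_inj) => /(_ ne).
  by rewrite !dotE.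
- move=> z hz r; rewrite mem_rev; apply: (cam_span C) => b bB.
  have := hz (- b); rewrite memN opprK mem_rev dotNr => /(_ bB) /eqP.
  by rewrite oppr_eq0 => /eqP.
Qed.

(** Applying s conjugates the product from s c to c s and keeps all signs, except that [- alpha s]
    becomes [alpha s] and must pass from N to P. As in [cambrian_peel], the members of N before it
    are orthogonal to it; [split_initial] also gives its obtuse angles with the images of P. *)
Lemma cambrian_rot c s P N : s \notin c -> cambrian (s :: c) P N -> alpha s \notin P ->
  exists P' N', cambrian (rcons c s) P' N' /\ P' ++ N' =i map (sf s) (P ++ N).
Proof.
move=> sc C sP.
(* The part that does not depend on whether [- alpha s] occurs in N. *)
have mk P' N' : P' ++ N' =i map (sf s) (P ++ N) -> uniq (P' ++ N') ->
    {in P', forall b, 0 < dot a b} -> {in N', forall b, dot a b < 0} ->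
    obtuse P' -> obtuse N' -> (forall z, rp (P' ++ N') z = rp (map (sf s) (P ++ N)) z) ->
    cambrian (rcons c s) P' N'.
  move=> e u hP hN oP oN hp; split=> //.
  - by move=> b; rewrite e => /mapP[b' /(cam_root C) h ->]; rewrite sf_root.
  - move=> b; rewrite e => /mapP[b' b'B ->] r; rewrite mem_rcons => rc.
    rewrite coef_sf ?(cam_supp C b'B) //.
    by move: rc; rewrite inE negb_or => /andP[].
  - move=> z; rewrite hp rp_map_rf (cam_prod C) ap_cons ap_rcons rfK //.
  - move=> b; rewrite e => /mapP[b' /(cam_dual C) [g gP] ->]; exists (sf s g).
    by apply: dual_vector_eq (dual_vector_map s gP) => x; rewrite e.
  - move=> z hz; have h r : r \in s :: c -> dot (sf s z) (alpha r) = 0.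
      apply: (cam_span C) => b bB; rewrite rf_adj; apply: hz; rewrite e; exact: map_f.
    have hs : dot z (alpha s) = 0.
      by have := h s (mem_head _ _); rewrite rf_adj sf_alpha dotNr => /eqP; rewrite oppr_eq0 => /eqP.
    by move=> r; rewrite mem_rcons => /h; rewrite rf_id.
have uB : uniq (map (sf s) (P ++ N)) by rewrite map_inj_uniq ?(cam_uniq C) //; exact: rf_inj.
have hP : {in map (sf s) P, forall b, 0 < dot a b}.
  move=> _ /mapP[b bP ->]; apply: sf_pos; [|exact: (cam_pos C)|].
  - by apply: (cam_root C); rewrite mem_cat bP.
  - by apply: contraNneq sP => <-.
have oP : obtuse (map (sf s) P) by apply/obtuse_map/(cam_obtP C).
have hN b : b \in N -> b != - alpha s -> dot a (sf s b) < 0.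
  move=> bN; apply: sf_neg; last exact: (cam_neg C).
  by apply: (cam_root C); rewrite mem_cat bN orbT.
have [sN|sN] := boolP (- alpha s \in N); last first.
  exists (map (sf s) P), (map (sf s) N); rewrite -map_cat; split=> //.
  apply: mk; rewrite -?map_cat //; last by apply/obtuse_map/(cam_obtN C).
  by move=> _ /mapP[b bN ->]; apply: hN => //; apply: contraNneq sN => <-.
case/splitPr: sN C sP mk uB hP oP hN => N1 N2 C sP mk uB hP oP hN.
have EB : P ++ N1 ++ - alpha s :: N2 = (P ++ N1) ++ - alpha s :: N2 by rewrite catA.
have := @split_initial c s (P ++ N1) (- alpha s) N2 sc.
rewrite -EB => /(_ (cam_uniq C) (cam_dual C) (cam_prod C) (or_intror erefl)) [h2 h1].
have uN : uniq (N1 ++ - alpha s :: N2).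
  by have := cam_uniq C; rewrite (cat_uniq P) => /and3P[].
have sN1 : - alpha s \notin N1 ++ N2.
  by move: uN; rewrite -cat1s uniq_catCA /= => /andP[].
have cm : {in N1, forall b, dot b (alpha s) = 0}.
  move=> b bN1; have bN : b \in N1 ++ - alpha s :: N2 by rewrite mem_cat bN1.
  have h0 : dot (v s) (sf s b) = 0 by apply: h1; rewrite mem_cat bN1 orbT.
  apply/eqP; rewrite eq_le; apply/andP; split.
    rewrite -oppr_ge0 -dotNl; apply: coef_alpha_le0; first by rewrite rfN dotNr h0 oppr0.
    rewrite dotNr oppr_ge0; apply: root_neg_coef; last exact: (cam_neg C).
    by apply: (cam_root C); rewrite mem_cat bN orbT.
  rewrite -oppr_le0 -dotNr; apply: (cam_obtN C) => //; first by rewrite mem_cat mem_head orbT.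
  by apply: contraNneq sN1 => <-; rewrite mem_cat bN1.
have eqm : (alpha s :: map (sf s) P) ++ map (sf s) (N1 ++ N2) =i
    map (sf s) (P ++ N1 ++ - alpha s :: N2).
  move=> x; rewrite /= EB !map_cat /= rfN sf_alpha opprK.
  rewrite [in RHS](mem_cat_cons _ _ (alpha s)) -map_cat -catA map_cat.
  by rewrite -map_cat.
exists (rcons (map (sf s) P) (alpha s)), (map (sf s) (N1 ++ N2)).
have eqm' : rcons (map (sf s) P) (alpha s) ++ map (sf s) (N1 ++ N2) =i
    map (sf s) (P ++ N1 ++ - alpha s :: N2).
  by move=> x; rewrite -eqm !mem_cat mem_rcons.
split=> //; apply: mk => //.
- have /perm_uniq -> // : perm_eq (rcons (map (sf s) P) (alpha s) ++ map (sf s) (N1 ++ N2))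
    (map (sf s) (P ++ N1 ++ - alpha s :: N2)).
  rewrite -cats1 -catA !map_cat /= rfN sf_alpha opprK perm_cat2l.
  by rewrite -cat1s -[in X in perm_eq _ X]cat1s perm_catCA.
- by move=> b; rewrite mem_rcons inE => /orP[/eqP->|/hP //]; exact: alpha_pos.
- move=> _ /mapP[b bN ->]; apply: hN; first by rewrite mem_cat_cons inE bN orbT.
  by apply: contraNneq sN1 => <-.
- apply: (@obtuse_sub _ (alpha s :: map (sf s) P)) => [b|]; first by rewrite mem_rcons.
  apply: obtuse_cons => // _ /mapP[b bP ->].
  rewrite dotC rf_adj sf_alpha dotNr oppr_le0; apply: coef_alpha_le0.
    by apply: h1; rewrite mem_cat bP.
  apply: root_pos_coef; last exact: (cam_pos C).
  by apply: (cam_root C); rewrite mem_cat bP.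
- apply/obtuse_map/obtuse_sub/(cam_obtN C) => b bN; by rewrite mem_cat_cons inE bN orbT.
- move=> z; rewrite -cats1 -catA !map_cat /= rfN sf_alpha opprK !rp_cat /=.
  rewrite rp_cat; congr (rp _ _); rewrite rp_comm // => _ /mapP[b /cm h ->].
  by rewrite rf_adj sf_alpha dotNr h oppr0.
Qed.

Lemma cambrian_unrot c s P N : s \notin c -> cambrian (rcons c s) P N -> - alpha s \notin N ->
  exists P' N', cambrian (s :: c) P' N' /\ P' ++ N' =i map (sf s) (P ++ N).
Proof.
move=> sc /cambrian_rev; rewrite rev_rcons => C sN.
have memN b (B : seq V) : (b \in map -%R B) = (- b \in B).
  by rewrite -{1}(opprK b) (mem_map oppr_inj).
have [||P' [N' [C' e]]] := cambrian_rot _ C; rewrite ?mem_rev ?memN ?mem_rev //.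
exists (map -%R (rev N')), (map -%R (rev P')); split.
  by have := cambrian_rev C'; rewrite rev_rcons revK.
move=> x; rewrite -map_cat -rev_cat memN mem_rev e -map_cat -rev_cat !mem_map_rf memN.
by rewrite rfN opprK mem_rev.
Qed.

Lemma cambrian_dual_fun c P N : cambrian c P N ->
  exists G : V -> V, {in P ++ N, forall b, dual_vector (P ++ N) b (G b)}.
Proof.
move=> C; have : forall b, exists g, b \in P ++ N -> dual_vector (P ++ N) b g.
  move=> b; have [bB|_] := boolP (b \in P ++ N); last by exists 0.
  by have [g gP] := cam_dual C bB; exists g.
by move=> /choice [G GP]; exists G => b; exact: GP.
Qed.

Lemma cambrian_dual_orth c s P N : s \notin c -> cambrian c P N ->
  exists G : V -> V, {in P ++ N, forall b,
    dual_vector (P ++ N) b (G b) /\ dot (G b) (alpha s) = 0}.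
Proof.
move=> sc C; have [G GP] := cambrian_dual_fun C.
exists (fun b => G b - dot (G b) (alpha s) *: v s) => b bB.
have [g1 g2] := GP _ bB.
have co x : x \in P ++ N -> dot (v s) x = 0 by move=> xB; apply: (cam_supp C).
rewrite dotBl dotZl dot_v_alpha eqxx mulr1 subrr; split=> //; split.
  by rewrite dotBl dotZl co // mulr0 subr0.
by move=> x xB ne; rewrite dotBl dotZl co // mulr0 subr0 g2.
Qed.

(** The reflection in [alpha s] cancels the one that conjugation by s puts in front of N, so the
    product becomes c s. Rotated back to s c, this is the cone beyond the wall [alpha s] of the cone
    of [alpha s :: P ++ N]. *)
Lemma cambrian_mutate c s P N : s \notin c -> cambrian c P N ->
  cambrian (rcons c s) (rcons P (alpha s)) (map (sf s) N).
Proof.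
move=> sc C; have co : {in P ++ N, forall b, dot (v s) b = 0}.
  by move=> b bB; apply: (cam_supp C).
have v1 : dot (v s) (alpha s) = 1 by rewrite dot_v_alpha eqxx.
have sB : alpha s \notin P ++ N.
  by apply/negP => /co /eqP; rewrite v1 oner_eq0.
have sB' : - alpha s \notin P ++ N.
  by apply/negP => /co /eqP; rewrite dotNr v1 oppr_eq0 oner_eq0.
pose phi b := if b \in P then b else sf s b.
have mem0 b : b \in rcons P (alpha s) ++ map (sf s) N ->
    b = alpha s \/ (exists2 b', b' \in P ++ N & b = phi b').
  rewrite mem_cat mem_rcons inE => /orP[/orP[/eqP->|bP]|/mapP[b' b'N ->]]; first by left.
    by right; exists b; rewrite ?mem_cat /phi bP.
  right; exists b'; first by rewrite mem_cat b'N orbT.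
  rewrite /phi ifN //; have := cam_uniq C; rewrite cat_uniq => /and3P[_ /hasPn h _].
  exact: h.
have phiR b : (phi b \in roots) = (b \in roots) by rewrite /phi; case: ifP; rewrite ?sf_root.
have phi_coef b r : r != s -> dot (v r) (phi b) = dot (v r) b.
  by move=> rs; rewrite /phi; case: ifP => // _; rewrite coef_sf.
have phi_orth g b : dot g (alpha s) = 0 -> dot g (phi b) = dot g b.
  by move=> h; rewrite /phi; case: ifP => // _; rewrite -rf_adj rf_id.
split.
- move=> b /mem0[->|[b' b'B ->]]; rewrite ?alpha_root ?phiR //; exact: (cam_root C).
- by move=> b; rewrite mem_rcons inE => /orP[/eqP->|/(cam_pos C) //]; exact: alpha_pos.
- move=> _ /mapP[b bN ->]; have bB : b \in P ++ N by rewrite mem_cat bN orbT.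
  apply: sf_neg; [exact: (cam_root C)|exact: (cam_neg C)|].
  by apply: contraNneq sB' => <-.
- have := cam_uniq C; rewrite cat_uniq => /and3P[uP /hasPn PN uN].
  rewrite cat_uniq; apply/and3P; split.
  + by rewrite rcons_uniq uP andbT; move: sB; rewrite mem_cat negb_or => /andP[].
  + apply/hasPn => _ /mapP[b bN ->]; rewrite /= mem_rcons inE negb_or; apply/andP; split.
      apply: contraNneq sB' => /(congr1 (sf s)); rewrite rfK sf_alpha => <-.
      by rewrite mem_cat bN orbT.
    apply/negP => h; have bB : b \in P ++ N by rewrite mem_cat bN orbT.
    have := cam_pos C h; rewrite ltNge => /negP; apply; apply/ltW/sf_neg.
    * exact: (cam_root C).
    * exact: (cam_neg C).
    * by apply: contraNneq sB' => <-.
  + by rewrite (map_inj_uniq (@rf_inj _ _ _)).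
- move=> b /mem0[->|[b' b'B ->]] r; rewrite mem_rcons inE negb_or => /andP[rs rc].
    by rewrite dot_v_alpha (negPf rs).
  by rewrite phi_coef // (cam_supp C b'B).
- move=> z; rewrite rp_cat rp_rcons rp_map_rf rfK -rp_cat (cam_prod C) ap_rcons //.
- apply: (@obtuse_sub _ (alpha s :: P)) => [b|]; first by rewrite mem_rcons.
  apply: obtuse_cons; last exact: (cam_obtP C).
  move=> b bP; rewrite dotC; have bB : b \in P ++ N by rewrite mem_cat bP.
  by apply: pos_dot_alpha_le0; [exact: (cam_root C)|exact: (cam_pos C)|exact: co].
- by apply/obtuse_map/(cam_obtN C).
- have [G GP] := cambrian_dual_orth sc C.
  move=> b /mem0[->|[b' b'B ->]]; last first.
    have [[g1 g2] gs] := GP _ b'B; exists (G b'); split; first by rewrite phi_orth.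
    move=> x /mem0[->//|[x' x'B ->]] ne; rewrite phi_orth // g2 //.
    by apply: contraNneq ne => ->.
  pose k q := 2 * dot q (alpha s) / dot (alpha s) (alpha s).
  (* The dual vectors of N offset the multiples of [alpha s] by which [sf s] changes the members of
     N. *)
  pose g := v s + \sum_(q <- N) k q *: G q.
  have inB q : q \in N -> q \in P ++ N by move=> qN; rewrite mem_cat qN orbT.
  have gs : dot g (alpha s) = 1.
    rewrite dotDl v1 dot_suml big_seq big1 ?addr0 // => q qN.
    by rewrite dotZl (GP _ (inB _ qN)).2 mulr0.
  exists g; split=> // x /mem0[->|[x' x'B ->]]; rewrite ?eqxx // => _.
  rewrite /phi; have [x'P|x'P] := boolP (x' \in P).
    rewrite dotDl co // add0r dot_suml big_seq big1 // => q qN.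
    rewrite dotZl (GP _ (inB _ qN)).1.2 ?mulr0 //.
    have := cam_uniq C; rewrite cat_uniq => /and3P[_ /hasPn h _].
    by apply: contraNneq (h _ qN) => <-.
  have x'N : x' \in N by move: x'B; rewrite mem_cat (negPf x'P).
  rewrite {1}/rf dotBr dotZr gs mulr1 dotDl co // add0r dot_suml.
  rewrite (bigD1_seq x') //=; last by have := cam_uniq C; rewrite cat_uniq => /and3P[].
  rewrite dotZl (GP _ x'B).1.1 mulr1 big_seq_cond big1 ?addr0 ?subrr // => q /andP[qN qx].
  by rewrite dotZl (GP _ (inB _ qN)).1.2 ?mulr0 // eq_sym.
- move=> z hz.
  have hs : dot z (alpha s) = 0 by apply: hz; rewrite mem_cat mem_rcons mem_head.
  move=> r; rewrite mem_rcons inE => /orP[/eqP->//|]; apply: (cam_span C) => b.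
  rewrite mem_cat => /orP[bP|bN]; first by apply: hz; rewrite mem_cat mem_rcons inE bP orbT.
  rewrite -{1}(rf_id hs) rf_adj; apply: hz; by rewrite mem_cat map_f ?orbT.
Qed.

End CambrianFamilies.

(** * Cones and regular points, adjacent cones, sorting words *)

Section CambrianFan.
Variables (R : realType) (n : nat) (d : root_datum R n).
Local Notation V := 'cV[R]_n.
Local Notation alpha := (rd_alpha d).
Local Notation v := (rd_v d).
Local Notation a := (rd_a d).
Local Notation roots := (rd_roots d).
Local Notation sf s := (rf (alpha s)).
Implicit Types (b y z g : V) (s t r : 'I_n) (c : seq 'I_n) (B P N : seq V).
Local Notation cambrian := (cambrian d).

Lemma mem_sym B B' : B =i B' -> B' =i B.
Proof. by move=> e b; rewrite e. Qed.

Lemma cambrian_mutate_neg c s P N : s \notin c -> cambrian c P N ->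
  exists P' N', cambrian (s :: c) P' N' /\
    P' ++ N' =i - alpha s :: (map (sf s) P ++ N).
Proof.
move=> sc C.
have [||P' [N' [C' e]]] := cambrian_unrot _ (cambrian_mutate sc C) => //.
  apply/negP; rewrite mem_map_rf rfN sf_alpha opprK => /(cam_neg C).
  by rewrite ltNge ltW // alpha_pos.
exists P', N'; split=> // b; rewrite e map_cat -map_comp map_rcons sf_alpha.
rewrite !(mem_cat, mem_rcons, inE) -orbA; congr [|| _, _ | _].
by rewrite (@eq_map _ _ _ id) ?map_id // => z /=; rewrite rfK.
Qed.

Lemma cambrian_nil : cambrian [::] [::] [::].
Proof. by split. Qed.

Lemma cambrian_nil_eq P N : cambrian [::] P N -> P ++ N = [::].
Proof.
move=> C; case E : (P ++ N) => [//|b B].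
have bB : b \in P ++ N by rewrite E mem_head.
have := root_nonzero (cam_root C bB); rewrite (expand_alpha d b) big1 ?eqxx // => s _.
by rewrite dotC (cam_supp C bB) // scale0r.
Qed.

(** The sum of [ninv d y] and the length of c decreases: a letter positive on y is deleted, while
    rotating a letter negative on y removes one inversion of y. *)
Lemma rotation_ind (T : seq 'I_n -> V -> Prop) :
  (forall y, regular d y -> T [::] y) ->
  (forall s c y, s \notin c -> uniq c -> regular d y -> 0 < dot y (alpha s) ->
    T c y -> T (s :: c) y) ->
  (forall s c y, s \notin c -> uniq c -> regular d y -> dot y (alpha s) < 0 ->
    T (rcons c s) (sf s y) -> T (s :: c) y) ->
  forall c y, uniq c -> regular d y -> T c y.
Proof.
move=> h0 hasc hdesc c y.
have [m] := ubnP (ninv d y + size c)%N; elim: m c y => // m IH [|s c] y; first by move=> _ _ /h0.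
move=> hm /= /andP[sc uc] ry; have := ry _ (alpha_root d s).
case: ltgtP => // hs _.
- apply: hdesc => //; apply: IH; last exact: regular_sf.
    by move: hm; rewrite (ninv_desc hs) size_rcons /= !addnS addSn ltnS.
  by rewrite rcons_uniq sc.
- by apply: hasc => //; apply: IH => //; move: hm; rewrite /= addnS ltnS.
Qed.

Lemma initial_asc c s P N y : s \notin c -> cambrian (s :: c) P N -> icone (P ++ N) y ->
  0 < dot y (alpha s) -> alpha s \in P.
Proof.
move=> sc C hy hs; apply: contraT => /(neg_on_initial sc C) /(_ y (icone_cone hy)).
by rewrite leNgt hs.
Qed.

Lemma initial_desc P N y s : icone (P ++ N) y -> dot y (alpha s) < 0 -> alpha s \notin P.
Proof.
move=> hy; apply: contraTN => sP; rewrite -leNgt ltW // hy // mem_cat sP //.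
Qed.

(** The numbers [dot z (v s)] are the coordinates of z in the basis of simple roots. *)
Definition in_lattice z := forall s, dot z (v s) \is a Num.int.

Lemma in_lattice_sf s z : in_lattice z -> in_lattice (sf s z).
Proof.
move=> h t; have [->|ts] := eqVneq t s; last by rewrite dotC coef_sf // dotC.
rewrite rf_adj dotC (dot_expand d); apply: rpred_sum => r _; apply: rpredM => //.
rewrite rf_adj; have [k ->] := alpha_int d s r.
by rewrite dotDr dotZr !dot_v_alpha eqxx mulr1 rpredD // ?rpred_int // rpred_nat.
Qed.

Lemma in_lattice_alpha s : in_lattice (alpha s).
Proof. by move=> t; rewrite dotC dot_v_alpha rpred_nat. Qed.

Lemma cambrian_exists c y : uniq c -> regular d y ->
  exists P N, [/\ cambrian c P N, icone (P ++ N) y & {in P ++ N, forall b, in_lattice b}].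
Proof.
move: c y; apply: rotation_ind => [y _|s c y sc uc ry hs [P [N [C hy hL]]]|
    s c y sc uc ry hs [P [N [C hy hL]]]].
- by exists [::], [::]; split=> //; exact: cambrian_nil.
- exists (alpha s :: P), N; split; first exact: cambrian_unpeel.
    by move=> b; rewrite inE => /orP[/eqP->|/hy].
  by move=> b; rewrite inE => /orP[/eqP->|/hL //]; exact: in_lattice_alpha.
- have [||P' [N' [C' e]]] := cambrian_unrot _ C => //.
    apply/negP => h; have := hy (- alpha s); rewrite mem_cat h orbT => /(_ isT).
    by rewrite rf_adj rfN sf_alpha opprK ltNge ltW.
  exists P', N'; split=> //; first by apply: icone_eq (mem_sym e) _; apply/icone_map.
  by move=> b; rewrite e => /mapP[b' /hL h ->]; apply: in_lattice_sf.
Qed.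

Lemma cambrian_unique c y : uniq c -> regular d y -> forall P N P' N',
  cambrian c P N -> cambrian c P' N' -> icone (P ++ N) y -> icone (P' ++ N') y ->
  P ++ N =i P' ++ N'.
Proof.
move: c y; apply: rotation_ind => [y _|s c y sc uc ry hs IH|s c y sc uc ry hs IH] P N P' N'.
- by move=> /cambrian_nil_eq -> /cambrian_nil_eq ->.
- move=> C C' hy hy'; have sP := initial_asc sc C hy hs; have sP' := initial_asc sc C' hy' hs.
  have [P1 C1 e1] := cambrian_peel sc C sP; have [P1' C1' e1'] := cambrian_peel sc C' sP'.
  move=> b; rewrite e1 e1' !inE; congr (_ || _); apply: IH => // x xB.
    by apply: hy; rewrite e1 inE xB orbT.
  by apply: hy'; rewrite e1' inE xB orbT.
- move=> C C' hy hy'; have sP := initial_desc hy hs; have sP' := initial_desc hy' hs.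
  have [Q [M [C1 e1]]] := cambrian_rot sc C sP.
  have [Q' [M' [C1' e1']]] := cambrian_rot sc C' sP'.
  have h : Q ++ M =i Q' ++ M'.
    apply: IH => //; [apply: icone_eq (mem_sym e1) _|
                      apply: icone_eq (mem_sym e1') _];
    by apply/icone_map; rewrite rfK.
  by move=> b; rewrite -(mem_map (@rf_inj _ _ (alpha s))) -e1 h e1' (mem_map (@rf_inj _ _ _)).
Qed.

(** Adding a large multiple of [v s] to z makes [alpha s] nonnegative, keeps the values on P and N,
    and cannot lower the value on a positive root. *)
Lemma neg_on_peel c s P N g : s \notin c -> cambrian c P N -> g \in roots -> 0 < dot a g ->
  neg_on (alpha s :: (P ++ N)) g -> neg_on (P ++ N) g.
Proof.
move=> sc C gR gp h z hz.
have := h (z + `|dot z (alpha s)| *: v s); rewrite dotDl dotZl => h1.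
apply: le_trans (h1 _); first by rewrite lerDl mulr_ge0 // root_pos_coef.
move=> b; rewrite inE => /orP[/eqP->|bB]; rewrite dotDl dotZl.
  by rewrite dot_v_alpha eqxx mulr1 addrC -lerBlDr sub0r (le_trans (ler_norm _)) ?normrN.
by rewrite (cam_supp C bB) // mulr0 addr0 hz.
Qed.

(** Regular points separated by the hyperplane of b alone, with y on the side of the dominant
    chamber. *)
Record adjacent y y' b : Prop := Adjacent {
  adj_reg : regular d y;
  adj_reg' : regular d y';
  adj_root : b \in roots;
  adj_pos : 0 < dot a b;
  adj_y : 0 < dot y b;
  adj_y' : dot y' b < 0;
  adj_other : forall b', b' \in roots -> 0 < dot a b' -> b' != b ->
    (0 < dot y b') = (0 < dot y' b')
}.

Lemma adj_sign y y' b b' : adjacent y y' b -> b' \in roots -> b' != b -> b' != - b ->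
  (0 < dot y b') = (0 < dot y' b').
Proof.
move=> A b'R ne ne'; case: (boolP (0 < dot a b')) => [hb|]; first exact: (adj_other A).
rewrite -(root_posN b'R) => hb.
have := adj_other A (rootN b'R); rewrite dotNr oppr_gt0 => /(_ hb).
rewrite -(inj_eq oppr_inj) opprK => /(_ ne'); rewrite !dotNr !oppr_gt0.
by rewrite (regular_neg (adj_reg A)) // (regular_neg (adj_reg' A)) // => /negb_inj.
Qed.

Lemma adjacent_sf s y y' b : adjacent y y' b -> b != alpha s ->
  adjacent (sf s y) (sf s y') (sf s b).
Proof.
move=> A bs; split; rewrite ?rf_iso ?(adj_y A) ?(adj_y' A) ?sf_root ?(adj_root A) //.
- exact/regular_sf/(adj_reg A).
- exact/regular_sf/(adj_reg' A).
- by apply: sf_pos; [exact: (adj_root A)|exact: (adj_pos A)|].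
- move=> b' b'R b'p ne; rewrite !rf_adj; apply: (adj_sign A); first by rewrite sf_root.
    by apply: contraNneq ne => <-; rewrite rfK.
  apply: contraTneq b'p => /(congr1 (sf s)); rewrite rfK rfN => ->.
  rewrite dotNr oppr_gt0 -leNgt ltW //.
  by apply: sf_pos; [exact: (adj_root A)|exact: (adj_pos A)|].
Qed.

(* In the second alternative the wall b lies in a facet of both Cambrian cones. *)
Lemma cambrian_edge c y : uniq c -> regular d y -> forall y' b P N P' N',
  adjacent y y' b -> cambrian c P N -> cambrian c P' N' ->
  icone (P ++ N) y -> icone (P' ++ N') y' ->
  (P ++ N =i P' ++ N' \/ exists D : seq (V * R),
     P ++ N =i b :: [seq e.1 | e <- D] /\
     P' ++ N' =i - b :: [seq e.1 + e.2 *: b | e <- D]) /\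
  (forall g, g \in roots -> 0 < dot a g -> neg_on (P ++ N) g -> neg_on (P' ++ N') g).
Proof.
move: c y; apply: rotation_ind => [y _|s c y sc uc ry hs IH|s c y sc uc ry hs IH]
  y' b P N P' N' A C C' hy hy'.
- by rewrite (cambrian_nil_eq C) (cambrian_nil_eq C'); split; first by left.
- have sP := initial_asc sc C hy hs; have [P1 C1 e1] := cambrian_peel sc C sP.
  have hy1 : icone (P1 ++ N) y by move=> x xB; apply: hy; rewrite e1 inE xB orbT.
  have v1 : dot (v s) (alpha s) = 1 by rewrite dot_v_alpha eqxx.
  have [hs'|hs'] := ltP 0 (dot y' (alpha s)).
    have sP' := initial_asc sc C' hy' hs'; have [P1' C1' e1'] := cambrian_peel sc C' sP'.
    have hy1' : icone (P1' ++ N') y' by move=> x xB; apply: hy'; rewrite e1' inE xB orbT.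
    have [h1 h2] := IH _ _ _ _ _ _ A C1 C1' hy1 hy1'; split; last first.
      move=> g gR gp hg; apply: (neg_on_eq (mem_sym e1')) => z hz.
      apply: (h2 g gR gp).
        by apply: (neg_on_peel sc C1) => //; apply: neg_on_eq hg.
      by move=> x xB; apply: hz; rewrite inE xB orbT.
    case: h1 => [h1|[D [D1 D2]]]; first by left=> x; rewrite e1 e1' !inE h1.
    right; exists ((alpha s, 0) :: D); split=> x.
      by rewrite e1 /= !inE D1 inE orbCA.
    by rewrite e1' /= !inE D2 inE scale0r addr0 orbCA.
  (* Here [alpha s] is positive on y but not on y', and b is the only positive root whose sign
     changes. *)
  have eb : b = alpha s.
    apply/eqP; apply: contraT => ne; have := adj_other A (alpha_root d s) (alpha_pos d s).
    by rewrite eq_sym => /(_ ne); rewrite hs ltNge hs'.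
  move: A; rewrite {b}eb => A.
  (* The cone across the wall should be the mutation at [alpha s]; uniqueness identifies it with the
     given family once y' is seen to lie in it. *)
  have [P2 [N2 [C2 e2]]] := cambrian_mutate_neg sc C1.
  have co x : x \in P1 ++ N -> dot (v s) x = 0 by move=> xB; apply: (cam_supp C1).
  have nes x : x \in P1 ++ N -> x != alpha s /\ x != - alpha s.
    move=> /co h; split; apply: contra_eqN h => /eqP ->; rewrite ?dotNr v1 ?oppr_eq0 oner_eq0 //.
  have dP x : x \in P1 -> dot x (alpha s) <= 0.
    move=> xP; have xB : x \in P1 ++ N by rewrite mem_cat xP.
    by apply: pos_dot_alpha_le0; [exact: (cam_root C1)|exact: (cam_pos C1)|exact: co].
  pose k x := - (2 * dot x (alpha s) / dot (alpha s) (alpha s)).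
  have kE x : sf s x = x + k x *: alpha s by rewrite /rf /k scaleNr.
  have kP x : x \in P1 -> 0 <= k x.
    move=> /dP h; rewrite /k oppr_ge0 pmulr_lle0 ?invr_gt0 ?alpha_dot_gt0 //.
    by rewrite pmulr_rle0.
  have hy2 : icone (P2 ++ N2) y'.
    move=> x; rewrite e2 inE mem_cat => /or3P[/eqP->|/mapP[p pP ->]|xN].
    - by rewrite dotNr oppr_gt0 (adj_y' A).
    - have pB : p \in P1 ++ N by rewrite mem_cat pP.
      rewrite -(adj_sign A); first by rewrite kE dotDr dotZr ltr_pwDl ?hy1 // mulr_ge0 ?kP // ltW.
      + by rewrite sf_root (cam_root C1).
      + apply: contraNneq (nes _ pB).2 => /(congr1 (sf s)); rewrite rfK sf_alpha => ->.
        by rewrite eqxx.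
      + apply: contraNneq (nes _ pB).1 => /(congr1 (sf s)); rewrite rfK rfN sf_alpha opprK => ->.
        by rewrite eqxx.
    - have xB : x \in P1 ++ N by rewrite mem_cat xN orbT.
      rewrite -(adj_sign A) ?hy1 ?(nes _ xB).1 ?(nes _ xB).2 //.
      exact: (cam_root C1).
  have usc : uniq (s :: c) by rewrite /= sc.
  have e : P' ++ N' =i P2 ++ N2 by apply: (cambrian_unique usc (adj_reg' A)).
  split.
    right; exists ([seq (p, k p) | p <- P1] ++ [seq (q, 0) | q <- N]).
    split=> x; rewrite ?e1 ?e ?e2 !inE; congr (_ || _).
      by rewrite map_cat -!map_comp /= !map_id.
    rewrite map_cat -!map_comp /= !mem_cat; congr (_ || _).
      by apply/mapP/mapP => -[p pP ->]; exists p => //=; rewrite ?kE.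
    by rewrite (@eq_map _ _ _ id) ?map_id // => q /=; rewrite scale0r addr0.
  move=> g gR gp hg; apply: (neg_on_eq (mem_sym e)) => z hz.
  have : neg_on (P1 ++ N) g by apply: (neg_on_peel sc C1) => //; apply: neg_on_eq hg.
  (* The mutated cone is contained in the cone of P1 and N: on it [alpha s] is nonpositive, and a
     member p of P1 is [sf s p] minus a nonnegative multiple of [alpha s]. *)
  apply=> x; rewrite mem_cat => /orP[xP|xN].
    have := hz (sf s x); rewrite e2 inE mem_cat map_f // orbT => /(_ isT).
    have := hz (- alpha s); rewrite e2 inE eqxx => /(_ isT).
    rewrite kE dotDr dotZr dotNr oppr_ge0 => h1 h2.
    have h3 : k x * dot z (alpha s) <= 0 by rewrite mulr_ge0_le0 ?kP.
    lra.
  by apply: hz; rewrite e2 inE mem_cat xN !orbT.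
- have sP := initial_desc hy hs; have [Q [M [C1 e1]]] := cambrian_rot sc C sP.
  have bs : b != alpha s.
    by apply: contraTneq (adj_y A) => ->; rewrite -leNgt ltW.
  have hs' : dot y' (alpha s) < 0.
    rewrite (regular_neg (adj_reg' A)) ?alpha_root // -(adj_other A) ?alpha_root ?alpha_pos //.
      by rewrite -leNgt ltW.
    by rewrite eq_sym.
  have sP' := initial_desc hy' hs'; have [Q' [M' [C1' e1']]] := cambrian_rot sc C' sP'.
  have hy1 : icone (Q ++ M) (sf s y).
    by apply: icone_eq (mem_sym e1) _; apply/icone_map; rewrite rfK.
  have hy1' : icone (Q' ++ M') (sf s y').
    by apply: icone_eq (mem_sym e1') _; apply/icone_map; rewrite rfK.
  have [h1 h2] := IH _ _ _ _ _ _ (adjacent_sf A bs) C1 C1' hy1 hy1'.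
  have m1 x : (x \in P ++ N) = (sf s x \in Q ++ M) by rewrite e1 mem_map_rf rfK.
  have m1' x : (x \in P' ++ N') = (sf s x \in Q' ++ M') by rewrite e1' mem_map_rf rfK.
  split.
    case: h1 => [h1|[D [D1 D2]]]; first by left=> x; rewrite m1 m1' h1.
    right; exists [seq (sf s e.1, e.2) | e <- D]; split=> x.
      rewrite m1 D1 !inE (inj_eq (@rf_inj _ _ _)); congr (_ || _).
      by rewrite -map_comp -mem_map_rf -map_comp.
    rewrite m1' D2 !inE -rfN (inj_eq (@rf_inj _ _ _)); congr (_ || _).
    rewrite -map_comp -mem_map_rf -map_comp; congr (_ \in _).
    by apply: eq_map => e /=; rewrite rfD rfZ rfK.
  move=> g gR gp hg; have [->|gs] := eqVneq g (alpha s); first exact: neg_on_initial sc C' sP'.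
  rewrite -(neg_on_map d s); apply: (neg_on_eq e1'); apply: h2; rewrite ?sf_root //.
    exact: sf_pos.
  by apply: (neg_on_eq (mem_sym e1)); apply/neg_on_map.
Qed.

(** This is the chamber of z + e y for small e > 0. The limit is encoded by lexicographic signs,
    that of z first and that of y to break ties, and descents of the pair are removed one at a
    time. *)
Lemma chamber_near z y : regular d y -> exists x,
  (forall b, b \in roots -> 0 < dot z b -> 0 < dot (ap d x a) b) /\
  (forall b, b \in roots -> dot z b = 0 -> 0 < dot y b -> 0 < dot (ap d x a) b).
Proof.
pose N z y : pred V := fun b => (dot z b < 0) || (dot z b == 0) && (dot y b < 0).
have [m] := ubnP (pcount d (N z y)); elim: m z y => // m IH z y hm ry.
case: (pselect (exists s, N z y (alpha s))) => [[s hs]|hn].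
  have ns : N z y (- alpha s) = false.
    move: hs; rewrite /N !dotNr !oppr_lt0 oppr_eq0.
    by case: ltgtP => //= _; case: ltgtP.
  have hc : (pcount d (N (sf s z) (sf s y)) < m)%N.
    have := pcount_sf d s (N z y); rewrite hs ns addn0 addn1 => E.
    move: hm; rewrite -E ltnS; apply: leq_trans; rewrite ltnS leq_eqVlt; apply/orP; left.
    by apply/eqP/eq_count => b /=; rewrite /N !rf_adj.
  have [x [h1 h2]] := IH _ _ hc (regular_sf s ry); exists (s :: x); split=> b bR hb.
    by rewrite ap_cons rf_adj h1 ?sf_root // rf_iso.
  by move=> hb'; rewrite ap_cons rf_adj h2 ?sf_root // rf_iso.
have {hn}hN s : ~~ N z y (alpha s) by apply/negP => h; apply: hn; exists s.
have zs s : 0 <= dot z (alpha s) by move: (hN s); rewrite /N negb_or -leNgt => /andP[].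
have zp b : b \in roots -> 0 < dot a b -> 0 <= dot z b.
  move=> bR bp; rewrite (dot_expand d); apply: sumr_ge0 => s _; rewrite mulr_ge0 //.
  by rewrite dotC root_pos_coef.
exists [::]; split=> b bR hb; rewrite /ap /=.
  apply: contraT; rewrite -(root_posN bR) => bn; have := zp (- b) (rootN bR).
  by rewrite !dotNr oppr_gt0 oppr_ge0 leNgt hb => /(_ bn).
move=> hyb; apply: contraT; rewrite -(root_posN bR) => bn.
have co s : 0 <= - dot b (v s) by rewrite oppr_ge0 dotC; exact: root_neg_coef.
(* These numbers are nonnegative and sum up to [- dot z b], which is zero. *)
have t0 s : - dot b (v s) * dot z (alpha s) = 0.
  have : \sum_s - dot b (v s) * dot z (alpha s) = 0.
    under eq_bigr do rewrite mulNr.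
    by rewrite sumrN -(dot_expand d) hb oppr0.
  move/eqP; rewrite psumr_eq0 => [/allP h|i _]; last by rewrite mulr_ge0.
  exact/eqP/h/mem_index_enum.
have : 0 <= - dot y b.
  rewrite (dot_expand d) -sumrN; apply: sumr_ge0 => s _; rewrite -mulNr.
  have /eqP := t0 s; rewrite mulf_eq0 => /orP[/eqP->|/eqP z0]; first by rewrite mul0r.
  rewrite mulr_ge0 //; move: (hN s); rewrite /N z0 ltxx eqxx /=.
  by rewrite -leNgt.
by rewrite oppr_ge0 leNgt hyb.
Qed.

(* run c y x: x is the c-sorting word of the largest c-sortable element below the
   chamber of y. *)
Inductive run : seq 'I_n -> V -> seq 'I_n -> Prop :=
| RunNil y : run [::] y [::]
| RunSkip s c y x : 0 < dot y (alpha s) -> run c y x -> run (s :: c) y x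
| RunUse s c y x : dot y (alpha s) < 0 -> run (rcons c s) (sf s y) x ->
    run (s :: c) y (s :: x).

Lemma run_exists c y : uniq c -> regular d y -> exists x, run c y x.
Proof.
move: c y; apply: rotation_ind => [y _|s c y sc uc ry hs [x h]|s c y sc uc ry hs [x h]].
- by exists [::]; exact: RunNil.
- by exists x; exact: RunSkip.
- by exists (s :: x); exact: RunUse.
Qed.

Lemma run_skip s c y x : 0 < dot y (alpha s) -> run (s :: c) y x -> run c y x.
Proof. by move=> hs h; inversion h; subst => //; move: hs; rewrite ltNge ltW. Qed.

Lemma run_use s c y x : dot y (alpha s) < 0 -> run (s :: c) y x ->
  exists2 x', x = s :: x' & run (rcons c s) (sf s y) x'.
Proof.
move=> hs h; inversion h; subst; first by move: hs; rewrite ltNge ltW.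
by exists x0.
Qed.

Lemma run_nil y x : run [::] y x -> x = [::].
Proof. by move=> h; inversion h. Qed.

Lemma run_same c y : uniq c -> regular d y -> forall y' x x' P N, regular d y' ->
  cambrian c P N -> icone (P ++ N) y -> icone (P ++ N) y' -> run c y x -> run c y' x' -> x = x'.
Proof.
move: c y; apply: rotation_ind => [y _|s c y sc uc ry hs IH|s c y sc uc ry hs IH]
  y' x x' P N ry' C hy hy'.
- by move=> /run_nil -> /run_nil ->.
- have sP := initial_asc sc C hy hs; have hs' : 0 < dot y' (alpha s).
    by apply: hy'; rewrite mem_cat sP.
  move=> /(run_skip hs) h /(run_skip hs') h'; have [P1 C1 e1] := cambrian_peel sc C sP.
  apply: (IH _ _ _ _ _ ry' C1 _ _ h h') => b bB.
    by apply: hy; rewrite e1 inE bB orbT.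
  by apply: hy'; rewrite e1 inE bB orbT.
- have sP := initial_desc hy hs; have hs' : dot y' (alpha s) < 0.
    rewrite (regular_neg ry') ?alpha_root //; apply: contra sP; exact: initial_asc C hy'.
  move=> /(run_use hs) [z -> h] /(run_use hs') [z' -> h'].
  have [Q [M [C1 e1]]] := cambrian_rot sc C sP.
  congr (_ :: _); apply: (IH _ _ _ _ _ (regular_sf s ry') C1 _ _ h h');
  by apply: icone_eq (mem_sym e1) _; apply/icone_map; rewrite rfK.
Qed.

(** The inversions of the projection depend on the cone alone. Together with the monotonicity of
    [neg_on] in [cambrian_edge] this makes the projection order preserving. *)
Lemma run_inversions c y : uniq c -> regular d y -> forall x P N,
  run c y x -> cambrian c P N -> icone (P ++ N) y ->
  forall g, g \in roots -> 0 < dot a g -> (dot (ap d x a) g < 0 <-> neg_on (P ++ N) g).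
Proof.
move: c y; apply: rotation_ind => [y ry|s c y sc uc ry hs IH|s c y sc uc ry hs IH]
  x P N h C hy g gR gp.
- rewrite (run_nil h) (cambrian_nil_eq C) /ap /=; split=> [|/(_ g)]; first by rewrite ltNge ltW.
  have /[swap]/[apply] : cone [::] g by [].
  by rewrite leNgt (root_dot_gt0 gR).
- have sP := initial_asc sc C hy hs; have [P1 C1 e1] := cambrian_peel sc C sP.
  rewrite (IH _ _ _ (run_skip hs h) C1) //; last first.
    by move=> b bB; apply: hy; rewrite e1 inE bB orbT.
  split=> hg; first by move=> z hz; apply: hg => b bB; apply: hz; rewrite e1 inE bB orbT.
  by apply: (neg_on_peel sc C1) => //; apply: neg_on_eq hg.
- have sP := initial_desc hy hs; have [Q [M [C1 e1]]] := cambrian_rot sc C sP.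
  have [x' -> h'] := run_use hs h.
  have hy1 : icone (Q ++ M) (sf s y).
    by apply: icone_eq (mem_sym e1) _; apply/icone_map; rewrite rfK.
  have {}IH := IH _ _ _ h' C1 hy1.
  rewrite ap_cons rf_adj; have [->|gs] := eqVneq g (alpha s); last first.
    rewrite IH ?sf_root ?sf_pos //; split=> h1; first by apply/(neg_on_map d s)/(neg_on_eq e1).
    by apply: (neg_on_eq (mem_sym e1)); apply/neg_on_map.
  split=> _; first exact: neg_on_initial sc C sP.
  rewrite sf_alpha dotNr oppr_lt0.
  (* If [alpha s] were an inversion of x', it would be nonpositive on the rotated cone, but it is
     positive on the point [sf s y] there. *)
  have r' := @regular_apa _ _ d x'; apply: contraT; rewrite -(regular_neg r') ?alpha_root //.
  move=> /(IH _ (alpha_root d s) (alpha_pos d s)) /(_ _ (icone_cone hy1)).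
  by rewrite rf_adj sf_alpha dotNr oppr_le0 leNgt hs.
Qed.

(** The chamber of x lies in the fibre that x labels; idempotence of the projection follows. *)
Lemma run_icone c y : uniq c -> regular d y -> forall x P N,
  run c y x -> cambrian c P N -> icone (P ++ N) y -> icone (P ++ N) (ap d x a).
Proof.
move: c y; apply: rotation_ind =>
  [y ry|s c y sc uc ry hs IH|s c y sc uc ry hs IH] x P N h C hy.
- by rewrite (cambrian_nil_eq C).
- have sP := initial_asc sc C hy hs; have [P1 C1 e1] := cambrian_peel sc C sP.
  have usc : uniq (s :: c) by rewrite /= sc.
  move=> b; rewrite e1 inE => /orP[/eqP->|bB].
    have r' := @regular_apa _ _ d x; apply: contraT; rewrite -(regular_neg r') ?alpha_root //.
    move=> /(run_inversions usc ry h C hy (alpha_root d s) (alpha_pos d s)).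
    by move=> /(_ _ (icone_cone hy)); rewrite leNgt hs.
  apply: (IH _ _ _ (run_skip hs h) C1) bB => b' b'B; apply: hy.
  by rewrite e1 inE b'B orbT.
- have sP := initial_desc hy hs; have [Q [M [C1 e1]]] := cambrian_rot sc C sP.
  have [x' -> h'] := run_use hs h.
  have hy1 : icone (Q ++ M) (sf s y).
    by apply: icone_eq (mem_sym e1) _; apply/icone_map; rewrite rfK.
  have := IH _ _ _ h' C1 hy1; move/(icone_eq e1)/icone_map.
  by rewrite -ap_cons.
Qed.

Lemma run_idem c y x : uniq c -> regular d y -> run c y x -> run c (ap d x a) x.
Proof.
move=> uc ry h; have [P [N [C hy _]]] := cambrian_exists uc ry.
have hx := run_icone uc ry h C hy; have rx := @regular_apa _ _ d x.
have [x' h'] := run_exists uc rx.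
by rewrite {2}(run_same uc ry rx C hy hx h h').
Qed.

End CambrianFan.

(** * Reduced words and the right weak order *)

Section WeakOrder.
Variables (R : realType) (n : nat) (d : root_datum R n).
Local Notation V := 'cV[R]_n.
Local Notation alpha := (rd_alpha d).
Local Notation v := (rd_v d).
Local Notation a := (rd_a d).
Local Notation roots := (rd_roots d).
Local Notation sf s := (rf (alpha s)).
Implicit Types (b y z g : V) (s t r : 'I_n) (c x u : seq 'I_n) (B P N : seq V).
Local Notation cambrian := (cambrian d).
Local Notation ap := (ap d).
Local Notation word_prod := (word_prod alpha).

Lemma word_prod_eq x x' : word_prod x = word_prod x' <-> ap x =1 ap x'.
Proof.
split=> [e z|e]; first by rewrite -!apE e.
apply/matrixP => i j; have := congr1 (fun m : V => m i 0) (e (delta_mx j 0)).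
by rewrite -!apE -!colE !mxE.
Qed.

Lemma ap_rf x b z : ap x (rf b z) = rf (ap x b) (ap x z).
Proof. by elim: x => //= s x IH; rewrite !ap_cons IH rf_conj. Qed.

Lemma ap_sf_swap x s : ap (rcons x s) =1 rf (ap x (alpha s)) \o ap x.
Proof. by move=> z /=; rewrite ap_rcons ap_rf. Qed.

Lemma ninv_ap_le x y : (ninv d (ap x y) <= size x + ninv d y)%N.
Proof.
elim: x => //= s x IH; rewrite ap_cons; have := ninv_sf d s (ap x y).
by case: ltgtP => _ /=; lia.
Qed.

Lemma ninv_a : ninv d a = 0%N.
Proof.
apply/eqP; rewrite -leqn0 leqNgt -has_count; apply/hasPn => b bR.
by rewrite negb_and -!leNgt le_total.
Qed.

(** The letter to delete is the one at which g, pulled back along the word, has become the simple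
    root of that letter. *)
Lemma exchange g x : g \in roots -> 0 < dot a g -> dot (ap x a) g < 0 ->
  exists x', size x = (size x').+1 /\ ap x' =1 rf g \o ap x.
Proof.
elim: x g => [|s x IH] g gR gp /=; first by rewrite ltNge ltW.
have [->|gs] := eqVneq g (alpha s); first by exists x; split=> // z /=; rewrite ap_cons rfK.
rewrite ap_cons rf_adj => /IH; rewrite sf_root sf_pos // => -[] // x' [e1 e2].
exists (s :: x'); split; first by rewrite /= e1.
by move=> z /=; rewrite !ap_cons e2 /= -rf_conj rfK.
Qed.

Definition red x := size x == ninv d (ap x a).

Lemma red_le x x' : red x -> ap x' =1 ap x -> (size x <= size x')%N.
Proof.
move=> /eqP -> e; rewrite -(e a); apply: leq_trans (ninv_ap_le _ _) _.
by rewrite ninv_a addn0.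
Qed.

Lemma red_cons s x : red (s :: x) = red x && (0 < dot (ap x a) (alpha s)).
Proof.
rewrite /red ap_cons /=; have := regular_apa (d := d) x (alpha_root d s).
have [h|h|//] := ltgtP (dot (ap x a) (alpha s)) 0 => _; rewrite ?andbT ?andbF.
  apply/eqP => h1; have := ninv_ap_le x a; rewrite ninv_a addn0 (ninv_desc h); lia.
by rewrite (ninv_asc h) eqSS.
Qed.

Lemma red_exists x : exists2 x', red x' & ap x' =1 ap x.
Proof.
elim: x => [|s x [x' r e]]; first by exists [::]; rewrite // /red /ap /= ninv_a.
have [h|h] := ltP 0 (dot (ap x' a) (alpha s)).
  by exists (s :: x') => [|z]; rewrite ?red_cons ?r ?h // !ap_cons e.
have {}h : dot (ap x' a) (alpha s) < 0.
  by rewrite (regular_neg (@regular_apa _ _ d x')) ?alpha_root // -leNgt.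
have [x2 [e1 e2]] := exchange (alpha_root d s) (alpha_pos d s) h.
exists x2 => [|z]; last by rewrite e2 /= e ap_cons.
by rewrite /red e2 /= -eqSS -e1 -(ninv_desc h).
Qed.

Lemma reduced_wordE w x : reduced_word alpha w x <-> word_prod x = w /\ red x.
Proof.
split=> [[<- h]|[<- r]]; last by split=> // u' /word_prod_eq e; exact: red_le.
split=> //; have [x' r e] := red_exists x.
have := h x' ((word_prod_eq _ _).2 e); rewrite /red => h1; rewrite eqn_leq.
rewrite -(e a) -(eqP r) h1 /=; apply: red_le r _ => z; by rewrite e.
Qed.

Lemma red_cat x u : red (x ++ u) -> red x /\ red u.
Proof.
move=> r; split; last first.
  have := ninv_ap_le x (ap u a); have := ninv_ap_le u a; rewrite ninv_a addn0 -ap_cat.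
  by move: r; rewrite /red size_cat; lia.
have [x' r' e] := red_exists x.
have := red_le (x' := x' ++ u) r; rewrite !size_cat => h.
have {}h : (size x <= size x')%N.
  by rewrite -(leq_add2r (size u)) h // => z; rewrite !ap_cat e.
rewrite /red eqn_leq -{1}(e a) -(eqP r') h /=.
by rewrite (leq_trans (ninv_ap_le _ _)) // ninv_a addn0.
Qed.

Lemma red_size_eq x x' : red x -> red x' -> ap x =1 ap x' -> size x = size x'.
Proof. by move=> /eqP -> /eqP -> ->. Qed.

(** At the first s in x the root [ap x1 (alpha s)] is an inversion of x, and its coordinate at s is
    1 because x1 fixes [v s]. Pulling back along a word without s keeps this coordinate, so the root
    would stay positive. *)
Lemma red_support x x0 s : red x -> ap x =1 ap x0 -> s \notin x0 -> s \notin x.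
Proof.
move=> r e sx0; apply/negP => sx.
have [x1 [x2 [ex sx1]]] : exists x1 x2, x = x1 ++ s :: x2 /\ s \notin x1.
  exists (take (index s x) x), (drop (index s x).+1 x); split.
    by rewrite -{2}(nth_index s sx) -drop_nth ?index_mem // cat_take_drop.
  by rewrite in_take_leq ?ltnn // ltnW // index_mem.
have [_] := red_cat (eq_ind _ red r _ ex); rewrite red_cons => /andP[_ h].
have : dot (ap x a) (ap x1 (alpha s)) < 0.
  by rewrite ex ap_cat ap_iso ap_cons rf_adj sf_alpha dotNr oppr_lt0.
rewrite e ltNge ltW // ap_adj; apply: (@coef_pos _ _ d _ s).
  by rewrite !ap_root alpha_root.
have -> : dot (v s) (ap (rev x0) (ap x1 (alpha s))) = dot (v s) (alpha s).
  rewrite -{1}(@ap_v _ _ d (rev x0) s) ?mem_rev // ap_iso.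
  by rewrite -{1}(@ap_v _ _ d x1 s) // ap_iso.
by rewrite dot_v_alpha eqxx ltr01.
Qed.

Lemma adjacent_red x t : red (rcons x t) ->
  adjacent d (ap x a) (ap (rcons x t) a) (ap x (alpha t)).
Proof.
move=> r; have bR : ap x (alpha t) \in roots by rewrite ap_root alpha_root.
have bp : 0 < dot a (ap x (alpha t)).
  apply: contraT; rewrite -(root_posN bR) => bn.
  (* Were this root negative, its opposite would be an inversion of x, and the exchange would
     shorten [rcons x t]. *)
  have [|||x' [e1 e2]] := @exchange (- ap x (alpha t)) x; rewrite ?rootNE //.
  - by rewrite dotNr oppr_gt0.
  - by rewrite dotNr ap_iso oppr_lt0 alpha_pos.
  have /(red_le r) : ap x' =1 ap (rcons x t).
    by move=> z; rewrite e2 /= rfNl ap_sf_swap.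
  by rewrite size_rcons e1; lia.
split=> //; try exact: regular_apa.
- by rewrite ap_iso alpha_pos.
- by rewrite ap_rcons ap_iso rf_adj sf_alpha dotNr oppr_lt0 alpha_pos.
- move=> b b'R b'p ne; rewrite ap_rcons !ap_adj rf_adj.
  set g := ap (rev x) b; have gR : g \in roots by rewrite ap_root.
  have gE : b = ap x g by rewrite /g apK.
  have g1 : g != alpha t by apply: contraNneq ne; rewrite gE => ->.
  have g2 : g != - alpha t.
    apply: contraTneq b'p => gt; rewrite gE gt -leNgt.
    have -> : ap x (- alpha t) = - ap x (alpha t) by rewrite /ap rpN.
    by rewrite dotNr oppr_le0 ltW.
  have [gp|] := boolP (0 < dot a g); first by rewrite sf_pos.
  rewrite -(root_posN gR) => gn; symmetry; apply/negbTE; rewrite -leNgt ltW //.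
  exact: sf_neg.
Qed.

(** Each letter of u crosses one wall away from the dominant chamber, so [cambrian_edge] applies
    letter by letter. *)
Lemma weak_neg_on c x u P N P' N' : uniq c -> red (x ++ u) ->
  cambrian c P N -> cambrian c P' N' ->
  icone (P ++ N) (ap x a) -> icone (P' ++ N') (ap (x ++ u) a) ->
  forall g, g \in roots -> 0 < dot a g -> neg_on (P ++ N) g -> neg_on (P' ++ N') g.
Proof.
move=> uc; elim/last_ind: u P' N' => [|u t IH] P' N'.
  rewrite cats0 => r C C' h h' g gR gp; apply: neg_on_eq.
  exact: (cambrian_unique uc (regular_apa x) C C').
rewrite -rcons_cat => r C C' h h' g gR gp hg.
have [r0 _] : red (x ++ u) /\ red [:: t] by apply: red_cat; rewrite cats1.
have [Q [M [CQ hQ _]]] := cambrian_exists uc (@regular_apa _ _ d (x ++ u)).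
have [_ m] := cambrian_edge uc (@regular_apa _ _ d _) (adjacent_red r) CQ C' hQ h'.
by apply: m => //; apply: IH r0 C CQ h hQ g gR gp hg.
Qed.

(** The first letter of a reduced word for x is also an inversion of u and can be split off on both
    sides; the inversion sets stay nested because [sf s] permutes the other positive roots. *)
Lemma weak_le_inv x u :
  (forall g, g \in roots -> 0 < dot a g -> dot (ap x a) g < 0 -> dot (ap u a) g < 0) ->
  right_weak_le alpha (word_prod x) (word_prod u).
Proof.
have [x' r e] := red_exists x; rewrite -((word_prod_eq _ _).2 e) -(e a) => {x e}.
elim: x' u r => [|s x IH] u.
  move=> _ _; have [u' r' e'] := red_exists u; exists [::], u'; split; last first.
    by apply/reduced_wordE; split=> //; apply/word_prod_eq.
  by apply/reduced_wordE; split; rewrite // /red /ap /= ninv_a.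
rewrite red_cons => /andP[r hs] h.
have hu : dot (ap u a) (alpha s) < 0.
  by apply: h; rewrite ?alpha_root ?alpha_pos // ap_cons rf_adj sf_alpha dotNr oppr_lt0.
have [|p [q []]] := IH (s :: u) r.
  move=> g gR gp hg; have gs : g != alpha s.
    by apply: contraTneq hg => ->; rewrite -leNgt ltW.
  by rewrite ap_cons rf_adj; apply: h; rewrite ?sf_root ?sf_pos // ap_cons rf_iso.
move=> /reduced_wordE [/word_prod_eq e1 r1] /reduced_wordE [/word_prod_eq e2 r2].
exists (s :: p), q; split; apply/reduced_wordE; split.
- by apply/word_prod_eq => z; rewrite !ap_cons e1.
- by rewrite red_cons r1 e1.
- by apply/word_prod_eq => z; rewrite ap_cons e2 ap_cons rfK.
- by rewrite /= red_cons r2 e2 ap_cons rf_adj sf_alpha dotNr oppr_gt0.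
Qed.

Lemma weak_le_antisym w w' : right_weak_le alpha w w' -> right_weak_le alpha w' w -> w = w'.
Proof.
move=> [x [u [/reduced_wordE [e1 r1] /reduced_wordE [e2 r2]]]].
move=> [x' [u' [/reduced_wordE [e3 r3] /reduced_wordE [e4 r4]]]].
have h1 := red_size_eq r1 r4 ((word_prod_eq _ _).1 (etrans e1 (esym e4))).
have h2 := red_size_eq r2 r3 ((word_prod_eq _ _).1 (etrans e2 (esym e3))).
have u0 : u = [::] by apply: size0nil; move: h1 h2; rewrite !size_cat; lia.
by rewrite -e1 -e2 u0 cats0.
Qed.

(** A letter is used only when it is a descent of the current element, so it can begin a reduced
    word of that element. *)
Lemma run_prefix c y x : run d c y x -> forall u, y = ap u a ->
  exists u', red (x ++ u') /\ ap (x ++ u') =1 ap u.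
Proof.
elim=> {c y x} [y|s c y x hs _ IH|s c y x hs _ IH] u yu.
- by have [z r e] := red_exists u; exists z.
- exact: IH.
- have [|z [r e]] := IH (s :: u); first by rewrite ap_cons yu.
  exists z; split=> [|q]; last by rewrite ap_cons e ap_cons rfK.
  by rewrite red_cons r e ap_cons -yu rf_adj sf_alpha dotNr oppr_gt0.
Qed.

Lemma run_weak_le c u x : run d c (ap u a) x ->
  right_weak_le alpha (word_prod x) (word_prod u).
Proof.
move=> /run_prefix /(_ u erefl) [z [r e]]; have [rx _] := red_cat r.
exists x, z; split; apply/reduced_wordE; split=> //; exact/word_prod_eq.
Qed.

Lemma run_max c u u' x : uniq c -> run d c (ap u a) x ->
  run d c (ap u' a) u' -> right_weak_le alpha (word_prod u') (word_prod u) ->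
  right_weak_le alpha (word_prod u') (word_prod x).
Proof.
move=> uc h h' [p [q [/reduced_wordE [/word_prod_eq e1 r1] /reduced_wordE [/word_prod_eq e2 r2]]]].
have [P [N [C hP _]]] := cambrian_exists uc (@regular_apa _ _ d u).
have [P' [N' [C' hP' _]]] := cambrian_exists uc (@regular_apa _ _ d u').
apply: weak_le_inv => g gR gp /(run_inversions uc (@regular_apa _ _ d _) h' C' hP' gR gp) hg.
apply/(run_inversions uc (@regular_apa _ _ d _) h C hP gR gp).
by apply: (weak_neg_on uc r2 C' C _ _ gR gp hg); rewrite ?e1 ?e2.
Qed.

End WeakOrder.

(** * Combinatorics of subwords of c c c .. *)

Section FactorWords.
Variable n : nat.
Implicit Types (s t : 'I_n) (c : seq 'I_n) (J : {set 'I_n}) (K : seq {set 'I_n}) (e : bool).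
Local Notation set0 := (@finset.set0 'I_n).

Lemma factor_word_cons c J K :
  factor_word c (J :: K) = restrict_word c J ++ factor_word c K.
Proof. by []. Qed.

Lemma factor_positions_cons c J K :
  factor_positions c (J :: K) =
  [seq index s c | s <- restrict_word c J] ++ [seq (p + size c)%N | p <- factor_positions c K].
Proof.
rewrite /factor_positions /= -[1%N]/(1 + 0)%N iotaDl -map_comp map_flatten; congr (_ ++ flatten _).
rewrite -map_comp; apply: eq_map => i /=; rewrite -map_comp; apply: eq_map => s /=; lia.
Qed.

Lemma size_factor_positions c K : size (factor_positions c K) = size (factor_word c K).
Proof.
elim: K => // J K IH; rewrite factor_positions_cons factor_word_cons !size_cat !size_map.
by rewrite IH.
Qed.

Definition set_mem s e J := if e then (s |: J)%SET else (J :\ s)%SET.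

Lemma in_set_mem s e J t : (t \in set_mem s e J) = if t == s then e else t \in J.
Proof. by rewrite /set_mem; case: e; rewrite !inE; case: eqP. Qed.

Lemma set_mem_twice s e e' J : set_mem s e (set_mem s e' J) = set_mem s e J.
Proof. by apply/setP => t; rewrite !in_set_mem; case: eqP. Qed.

Lemma set_mem_id s J : set_mem s (s \in J) J = J.
Proof. by apply/setP => t; rewrite in_set_mem; case: eqP => // ->. Qed.

Lemma set_mem0 s : set_mem s false set0 = set0.
Proof. by apply/setP => t; rewrite in_set_mem inE; case: eqP. Qed.

(* A subword of (s c)^oo seen as a subword of (c s)^oo, and conversely: only the
   copy of c to which an occurrence of s is attributed changes. *)
Fixpoint unrot_factors s K : seq {set 'I_n} :=
  if K is J :: K' then set_mem s (s \in head set0 K') J :: unrot_factors s K' else [::].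

Fixpoint rot_factors s e K : seq {set 'I_n} :=
  if K is J :: K' then set_mem s e J :: rot_factors s (s \in J) K'
  else [:: set_mem s e set0].

Lemma head_rot_factors s e K : (s \in head set0 (rot_factors s e K)) = e.
Proof. by case: K => [|J K] /=; rewrite in_set_mem eqxx. Qed.

(** Rotation lengthens the list by one factor, hence the empty set at the end; it affects neither
    words nor positions. *)
Lemma rot_factorsK s e K : unrot_factors s (rot_factors s e K) = rcons K set0.
Proof.
elim: K e => [|J K IH] e /=; first by rewrite set_mem_twice inE set_mem0.
by rewrite head_rot_factors set_mem_twice set_mem_id IH.
Qed.

Lemma nth_unrot_factors s K i :
  nth set0 (unrot_factors s K) i = set_mem s (s \in nth set0 K i.+1) (nth set0 K i).
Proof.
by elim: K i => [|J K IH] [|i] /=; rewrite ?nth_nil ?inE ?set_mem0 ?nth0.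
Qed.

Lemma nth_rot_factors s e K i :
  nth set0 (rot_factors s e K) i =
  set_mem s (if i is j.+1 then s \in nth set0 K j else e) (nth set0 K i).
Proof.
elim: K e i => [|J K IH] e [|i] //=; first by rewrite !nth_nil inE set_mem0.
by rewrite IH; case: i.
Qed.

Definition nested K := forall i, nth set0 K i.+1 \subset nth set0 K i.

Lemma nestedP K : sorted (fun J J' : {set 'I_n} => J' \subset J) K <-> nested K.
Proof.
split=> [/(sortedP set0) h i|h]; last by apply/(sortedP set0) => i _; exact: h.
have [/h //|hi] := ltnP i.+1 (size K).
by rewrite [nth _ _ i.+1]nth_default // finset.sub0set.
Qed.

Lemma nested_unrot s K : nested K -> nested (unrot_factors s K).
Proof.
move=> h i; apply/fintype.subsetP => t; rewrite !nth_unrot_factors !in_set_mem.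
by case: eqP => [_|_]; apply: (fintype.subsetP (h _)).
Qed.

Lemma nested_rot s K : nested K -> nested (rot_factors s true K).
Proof.
move=> h i; apply/fintype.subsetP => t; rewrite !nth_rot_factors !in_set_mem.
case: eqP => [_|_]; last exact: (fintype.subsetP (h _)).
by case: i => // i; apply: (fintype.subsetP (h _)).
Qed.

Lemma restrict_cons s c J : restrict_word (s :: c) J = nseq (s \in J) s ++ restrict_word c J.
Proof. by rewrite /restrict_word /=; case: (s \in J). Qed.

Lemma restrict_set_mem s c e J : s \notin c -> restrict_word c (set_mem s e J) = restrict_word c J.
Proof.
move=> sc; apply: eq_in_filter => t tc; rewrite in_set_mem; case: eqP => // e1.
by move: sc; rewrite -e1 tc.
Qed.

Lemma restrict_rcons s c e J : s \notin c ->
  restrict_word (rcons c s) (set_mem s e J) = restrict_word c J ++ nseq e s.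
Proof.
move=> sc; rewrite {1}/restrict_word filter_rcons in_set_mem eqxx.
rewrite -/(restrict_word _ _) restrict_set_mem //.
by case: e; rewrite ?cats1 ?cats0.
Qed.

Lemma factor_word_rot s c K : s \notin c ->
  factor_word (s :: c) K =
  nseq (s \in head set0 K) s ++ factor_word (rcons c s) (unrot_factors s K).
Proof.
move=> sc; elim: K => [|J K IH]; first by rewrite /= inE.
by rewrite factor_word_cons IH restrict_cons /= factor_word_cons restrict_rcons // !catA.
Qed.

Lemma factor_positions_rot s c K : s \notin c ->
  factor_positions (s :: c) K =
  nseq (s \in head set0 K) 0%N ++
  map succn (factor_positions (rcons c s) (unrot_factors s K)).
Proof.
move=> sc; elim: K => [|J K IH]; first by rewrite /= inE.
rewrite factor_positions_cons IH restrict_cons /= factor_positions_cons restrict_rcons //.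
rewrite !map_cat !map_nseq -!catA /= eqxx; congr (_ ++ _).
have -> : index s (rcons c s) = size c by rewrite -cats1 index_cat (negPf sc) /= eqxx addn0.
rewrite size_rcons -!map_comp; congr (_ ++ _ ++ _).
apply/eq_in_map => t; rewrite mem_filter => /andP[_ tc] /=.
rewrite -cats1 index_cat tc ifN //.
by apply: contraNneq sc => ->.
Qed.

Lemma factor_word_rcons0 c K : factor_word c (rcons K set0) = factor_word c K.
Proof.
elim: K => [|J K IH]; last by rewrite rcons_cons !factor_word_cons IH.
rewrite /= /factor_word /= /restrict_word cats0 (@eq_filter _ _ pred0) ?filter_pred0 //.
by move=> t; rewrite /= inE.
Qed.

Lemma factor_positions_rcons0 c K :
  factor_positions c (rcons K set0) = factor_positions c K.
Proof.
elim: K => [|J K IH]; last by rewrite rcons_cons !factor_positions_cons IH.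
by apply: size0nil; rewrite size_factor_positions (factor_word_rcons0 c [::]).
Qed.

Lemma factor_positions_nil K : factor_positions [::] K = [::].
Proof. by apply: size0nil; rewrite size_factor_positions; elim: K. Qed.

(** With m the length of c, position p of c c c ... becomes this position of the infinite word of s
    c: one letter s precedes each of the [p %/ m] complete copies and one more opens the current
    copy. *)
Definition skip_position m p := (p + p %/ m).+1.

Lemma skip_factor_word s c K : s \notin factor_word (s :: c) K ->
  factor_word (s :: c) K = factor_word c K.
Proof.
elim: K => // J K IH; rewrite !factor_word_cons restrict_cons !mem_cat.
by rewrite mem_nseq eqxx; case: (s \in J) => //= /norP[_ /IH ->].
Qed.

Lemma skip_factor_positions s c K : s \notin c -> s \notin factor_word (s :: c) K ->
  factor_positions (s :: c) K = map (skip_position (size c)) (factor_positions c K).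
Proof.
move=> sc; elim: K => // J K IH; rewrite factor_word_cons restrict_cons !mem_cat mem_nseq eqxx.
rewrite !factor_positions_cons restrict_cons; case: (s \in J) => //= /norP[_ /IH ->].
rewrite map_cat -!map_comp; congr (_ ++ _).
  apply/eq_in_map => t; rewrite mem_filter => /andP[_ tc] /=.
  rewrite ifN; last by apply: contraNneq sc => ->.
  by rewrite /skip_position divn_small ?addn0 // index_mem.
case: c {sc IH} => [|t c]; first by rewrite factor_positions_nil.
apply: eq_map => p /=; rewrite /skip_position divnDr // divnn /=; lia.
Qed.

Lemma skip_position_mono m : {mono skip_position m : p q / (p <= q)%N}.
Proof.
apply: leq_mono => p q pq; rewrite /skip_position ltnS.
by rewrite -addSn leq_add // leq_div2r // ltnW.
Qed.

Lemma lexi_map (f : nat -> nat) (l l' : seq nat) : {mono f : p q / (p <= q)%N} ->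
  ((map f l : seqlexi nat) <= map f l')%O = ((l : seqlexi nat) <= l')%O.
Proof.
move=> hf; elim: l l' => [|p l IH] [|q l'] //.
by rewrite /= !Order.SeqLexiOrder.Exports.lexi_cons IH !leEnat !hf.
Qed.

(** One letter per copy: every word in the letters of c is a subword of c c c ... *)
Lemma factor_word_singletons c l : uniq c -> {subset l <= c} ->
  factor_word c (map (@finset.set1 _) l) = l.
Proof.
move=> uc; elim: l => // t l IH sub; rewrite /= factor_word_cons IH; last first.
  by move=> r rl; apply: sub; rewrite inE rl orbT.
rewrite /restrict_word (@eq_filter _ _ (pred1 t)) => [|r]; last by rewrite /= inE.
by rewrite filter_pred1_uniq // sub // mem_head.
Qed.

Lemma mem_factor_word c K s : s \in factor_word c K -> s \in c.
Proof. by move=> /flattenP[_ /mapP[J _ ->]]; rewrite mem_filter => /andP[]. Qed.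

Lemma mem_factor_positions c K p : p \in factor_positions c K -> (p < size K * size c)%N.
Proof.
elim: K p => // J K IH p; rewrite factor_positions_cons mem_cat => /orP[/mapP[s]|/mapP[q]].
  rewrite mem_filter => /andP[_ sc] ->; rewrite mulSn ltn_addr //.
  by rewrite index_mem.
by move=> /IH + -> /=; rewrite mulSn addnC ltn_add2l.
Qed.

(** Dropping the factors without letters realizes the minimal p. In a nested K they form a tail, so
    no position changes. *)
Definition trim_factors c K := [seq J <- K | restrict_word c J != [::]].

Lemma trim_factor_word c K : factor_word c (trim_factors c K) = factor_word c K.
Proof.
elim: K => // J K IH; rewrite /trim_factors /=; case: eqP => /= [e|_].
  by rewrite -/(trim_factors c K) IH factor_word_cons e.
by rewrite !factor_word_cons -/(trim_factors c K) IH.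
Qed.

Lemma trim_factor_positions c K : nested K ->
  factor_positions c (trim_factors c K) = factor_positions c K.
Proof.
elim: K => // J K IH nK.
have nK' : nested K by move=> i; exact: (nK i.+1).
rewrite /trim_factors /=; case: eqP => /= [e|_]; last first.
  by rewrite !factor_positions_cons -/(trim_factors c K) IH.
have E : factor_word c (J :: K) = [::].
  suff : forall J', J' \in J :: K -> restrict_word c J' = [::].
    elim: (J :: K) => // J' K' IH' h; rewrite factor_word_cons h ?mem_head // IH' // => J2 J2K.
    by apply: h; rewrite inE J2K orbT.
  move=> J' /(nthP set0) [i _ <-]; elim: i => // i IHi.
  apply/eqP; rewrite -[_ == _]negbK -has_filter; apply/hasPn => t tc.
  move/eqP: IHi; rewrite -[_ == _]negbK -has_filter => /hasPn /(_ t tc).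
  by apply: contra; exact: (fintype.subsetP (nK _)).
rewrite [RHS]size0nil ?size_factor_positions ?E //; apply: size0nil.
rewrite size_factor_positions trim_factor_word; move: E; rewrite factor_word_cons.
by case: (restrict_word c J) => //= ->.
Qed.

Lemma nested_trim c K : nested K -> nested (trim_factors c K).
Proof.
move=> /nestedP h; apply/nestedP; apply: sorted_filter h => J1 J2 J3 /= h1 h2.
exact: fintype.subset_trans h2 h1.
Qed.

(** The last factor keeps a letter, so some selected position lies in the last copy of c, out of
    reach of a shorter list. *)
Lemma trim_minimal c K K' : factor_positions c K' = factor_positions c (trim_factors c K) ->
  (size (trim_factors c K) <= size K')%N.
Proof.
have : all (fun J => restrict_word c J != [::]) (trim_factors c K) by exact: filter_all.
move: (trim_factors c K) => {}K hK eK.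
case/lastP: K => [//|K J] in hK eK *.
have [p pK hp] : exists2 p, p \in factor_positions c (rcons K J) & (size K * size c <= p)%N.
  move: hK; rewrite all_rcons => /andP[hJ _] {eK}.
  elim: K => [|J' K [p pK hp]].
    case E : (restrict_word c J) hJ => [//|t l] _; exists (index t c); last by rewrite mul0n.
    by rewrite /= factor_positions_cons E mem_cat mem_head.
  exists (p + size c)%N; last by rewrite /= mulSn addnC leq_add2r.
  by rewrite rcons_cons factor_positions_cons mem_cat; apply/orP; right; apply/mapP; exists p.
rewrite -eK in pK; have := leq_ltn_trans hp (mem_factor_positions pK).
by rewrite ltn_mul2r size_rcons => /andP[].
Qed.

End FactorWords.

Arguments set_mem : simpl never.

(** * Sortable elements and their recursion on the initial letter *)

Section Sortable.
Variables (R : realType) (n : nat) (d : root_datum R n).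
Local Notation V := 'cV[R]_n.
Local Notation alpha := (rd_alpha d).
Local Notation v := (rd_v d).
Local Notation a := (rd_a d).
Local Notation roots := (rd_roots d).
Local Notation sf s := (rf (alpha s)).
Implicit Types (s t : 'I_n) (c x u : seq 'I_n) (K : seq {set 'I_n}).
Local Notation set0 := (@finset.set0 'I_n).
Local Notation ap := (ap d).
Local Notation word_prod := (word_prod alpha).

Definition lexmin c w K := reduced_word alpha w (factor_word c K) /\
  forall K', reduced_word alpha w (factor_word c K') ->
    ((factor_positions c K : seqlexi nat) <= factor_positions c K')%O.

Lemma sortableE c w : sortable alpha c w <-> exists K, lexmin c w K /\ nested K.
Proof.
split=> [[K [[h1 h2 _] /nestedP h3]]|[K [[h1 h2] h3]]]; first by exists K.
exists (trim_factors c K); split; last by apply/nestedP/nested_trim.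
split.
- by rewrite trim_factor_word.
- by rewrite trim_factor_positions.
- by move=> K'; exact: trim_minimal.
Qed.

(** A reduced word of w cannot begin with s, so s is missing from the first factor and, by nesting,
    from all. Conversely, one word in the letters of c keeps s out of all reduced words by
    [red_support]. The positions in the two infinite words correspond under the increasing map
    [skip_position]. *)
Lemma sortable_skip s c w : s \notin c -> uniq c -> 0 < dot (w *m a) (alpha s) ->
  sortable alpha (s :: c) w <-> sortable alpha c w.
Proof.
move=> sc uc hs; rewrite !sortableE.
have first_letter x : reduced_word alpha w (s :: x) -> False.
  move=> /reduced_wordE [e]; rewrite red_cons => /andP[_ h]; move: hs.
  by rewrite -e apE ap_cons rf_adj sf_alpha dotNr oppr_gt0 ltNge ltW.
split=> -[K [[h1 h2] h3]].
  have sK i : s \notin nth set0 K i.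
    elim: i => [|i IH]; last by apply: contra IH; exact: (fintype.subsetP (h3 i)).
    apply/negP => sJ; case: K h1 sJ {h2 h3} => [|J K]; first by rewrite nth_nil inE.
    by move=> + /= sJ; rewrite factor_word_cons restrict_cons sJ => /first_letter.
  have sF : s \notin factor_word (s :: c) K.
    apply/negP => /flattenP[_ /mapP[J /(nthP set0) [i _ <-] ->]].
    by rewrite mem_filter (negPf (sK i)).
  exists K; split=> //; split; first by rewrite -(skip_factor_word sF).
  (* Erasing s changes neither the word nor the positions in c, which does not contain s. *)
  move=> K' h'; pose K2 := [seq set_mem s false J | J <- K'].
  have E (c' : seq 'I_n) : s \notin c' -> factor_word c' K2 = factor_word c' K'.
    move=> sc'; rewrite /K2; elim: (K') => //= J K0 IH; rewrite !factor_word_cons IH.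
    by rewrite restrict_set_mem.
  have E' : factor_positions c K2 = factor_positions c K'.
    rewrite /K2; elim: (K') => //= J K0 IH; rewrite !factor_positions_cons IH.
    by rewrite restrict_set_mem.
  have sF2 : s \notin factor_word (s :: c) K2.
    apply/negP => /flattenP[_ /mapP[_ /mapP[J _ ->] ->]].
    by rewrite mem_filter in_set_mem eqxx.
  have := h2 K2; rewrite (skip_factor_word sF2) (E c sc) => /(_ h').
  rewrite !skip_factor_positions // E' lexi_map //; exact: skip_position_mono.
pose K2 := [seq set_mem s false J | J <- K].
have E : factor_word c K2 = factor_word c K.
  rewrite /K2; elim: (K) => //= J K0 IH; rewrite !factor_word_cons IH.
  by rewrite restrict_set_mem.
have E' : factor_positions c K2 = factor_positions c K.
  rewrite /K2; elim: (K) => //= J K0 IH; rewrite !factor_positions_cons IH.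
  by rewrite restrict_set_mem.
have sF2 : s \notin factor_word (s :: c) K2.
  apply/negP => /flattenP[_ /mapP[_ /mapP[J _ ->] ->]].
  by rewrite mem_filter in_set_mem eqxx.
exists K2; split; last first.
  have nthE i : nth set0 K2 i = set_mem s false (nth set0 K i).
    have [hi|hi] := ltnP i (size K); first by rewrite (nth_map set0).
    by rewrite !nth_default ?size_map // set_mem0.
  move=> i; rewrite !nthE; apply/fintype.subsetP => t; rewrite !in_set_mem; case: eqP => // _.
  exact: (fintype.subsetP (h3 i)).
split; first by rewrite skip_factor_word // E.
move=> K' h'; have sF' : s \notin factor_word (s :: c) K'.
  move: (h1) (h') => /reduced_wordE [e1 _] /reduced_wordE [e2 r2].
  apply: (red_support r2 (x0 := factor_word c K)).
    by apply/word_prod_eq; rewrite e1 e2.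
  by apply: contra sc; exact: mem_factor_word.
rewrite !skip_factor_positions // E' lexi_map; last exact: skip_position_mono.
by apply: h2; rewrite -(skip_factor_word sF').
Qed.

Lemma reduced_use s w x : reduced_word alpha w (s :: x) ->
  reduced_word alpha (reflection (alpha s) *m w) x.
Proof.
move=> /reduced_wordE [e]; rewrite red_cons => /andP[r _]; apply/reduced_wordE; split=> //.
have -> : w = word_prod (s :: x) by [].
suff -> : reflection (alpha s) *m word_prod (s :: x) = word_prod [:: s, s & x].
  by apply/word_prod_eq => z; rewrite !ap_cons rfK.
by rewrite /word_prod !big_cons.
Qed.

Lemma reduced_use_inv s w x : dot (w *m a) (alpha s) < 0 ->
  reduced_word alpha (reflection (alpha s) *m w) x -> reduced_word alpha w (s :: x).
Proof.
move=> hs /reduced_wordE [e r].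
have e' : word_prod (s :: x) = w.
  rewrite /word_prod big_cons -/(word_prod x) e.
  have -> : reflection (alpha s) *m (reflection (alpha s) *m w) =
    word_prod [:: s; s] *m w by rewrite /word_prod !big_cons big_nil mulmx1 mulmxA.
  have -> : word_prod [:: s; s] = word_prod [::].
    by apply/word_prod_eq => z; rewrite !ap_cons rfK.
  by rewrite /word_prod big_nil mul1mx.
apply/reduced_wordE; split=> //; rewrite red_cons r /=.
move: hs; rewrite -e' apE ap_cons rf_adj sf_alpha dotNr oppr_lt0 //.
Qed.

(** As s is a descent, some reduced word of w begins with s and uses position 0, so the
    lexicographically first one does too. Deleting this letter shifts the positions by one and
    leaves a subword of the infinite word of c s. *)
Lemma sortable_use s c w : s \notin c -> uniq c -> dot (w *m a) (alpha s) < 0 ->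
  (exists u, w = word_prod u) ->
  sortable alpha (s :: c) w <->
  sortable alpha (rcons c s) (reflection (alpha s) *m w).
Proof.
move=> sc uc hs [u wu]; rewrite !sortableE.
have Frot K : s \in head set0 K -> factor_word (s :: c) K =
    s :: factor_word (rcons c s) (unrot_factors s K) /\
    factor_positions (s :: c) K =
    0%N :: map succn (factor_positions (rcons c s) (unrot_factors s K)).
  by move=> h; rewrite factor_word_rot // factor_positions_rot // h.
have lexi0 (l l' : seq nat) : ((0%N :: map succn l : seqlexi nat) <= 0%N :: map succn l')%O =
    ((l : seqlexi nat) <= l')%O.
  by rewrite Order.SeqLexiOrder.Exports.lexi_cons lexx /= lexi_map.
have NE x : reduced_word alpha w x -> size x != 0%N.
  move=> /reduced_wordE [e _]; apply: contraTN hs => /eqP /size0nil x0.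
  by rewrite -e apE x0 -leNgt ltW // alpha_pos.
split=> -[K [[h1 h2] h3]].
  have sK : s \in head set0 K.
    have [x [rx ex]] : exists x, reduced_word alpha w (s :: x) /\ {subset s :: x <= s :: c}.
      have [x r e] := red_exists d (s :: u); exists x.
      have hx : reduced_word alpha w (s :: x).
        apply: reduced_use_inv => //; apply/reduced_wordE; split=> //.
        by rewrite wu ((word_prod_eq _ _ _).2 e) /word_prod big_cons.
      split=> // t tx; apply: contraLR tx => tc; move: (h1) hx.
      move=> /reduced_wordE [e1 _] /reduced_wordE [e2 r2].
      apply: (red_support r2 (x0 := factor_word (s :: c) K)).
        by apply/word_prod_eq; rewrite e1 e2.
      by apply: contra tc; exact: mem_factor_word.
    have usc : uniq (s :: c) by rewrite /= sc.
    (* The competitor takes one letter from each copy, s first, so its first position is 0. *)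
    have := h2 (map (@finset.set1 _) (s :: x)); rewrite factor_word_singletons // => /(_ rx).
    have [_ ->] := @Frot (map (@finset.set1 _) (s :: x)) (finset.set11 s).
    have := NE _ h1; rewrite -size_factor_positions factor_positions_rot //.
    case: (s \in head set0 K) => //=; rewrite size_map.
    by case: (factor_positions _ _) => // p l _; rewrite Order.SeqLexiOrder.Exports.lexi_cons.
  have [F1 F2] := Frot K sK.
  exists (unrot_factors s K); split; last exact: nested_unrot.
  split; first by apply: reduced_use; rewrite -F1.
  move=> K' h'; have sK' := head_rot_factors s true K'.
  have [G1 G2] := Frot (rot_factors s true K') sK'.
  rewrite rot_factorsK factor_word_rcons0 factor_positions_rcons0 in G1 G2.
  have := h2 (rot_factors s true K'); rewrite G1 G2 F2 lexi0; apply.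
  exact: reduced_use_inv.
have sK := head_rot_factors s true K; have [F1 F2] := Frot (rot_factors s true K) sK.
rewrite rot_factorsK factor_word_rcons0 factor_positions_rcons0 in F1 F2.
exists (rot_factors s true K); split; last exact: nested_rot.
split; first by rewrite F1; exact: reduced_use_inv.
move=> K' h'; rewrite F2.
case sK' : (s \in head set0 K').
  have [G1 G2] := Frot K' sK'; rewrite G2 lexi0; apply: h2; apply: reduced_use.
  by rewrite -G1.
have := NE _ h'; rewrite -size_factor_positions factor_positions_rot // sK' /= size_map.
by case: (factor_positions _ _) => // p l _; rewrite Order.SeqLexiOrder.Exports.lexi_cons.
Qed.

Lemma sortable_word c w : sortable alpha c w -> exists u, w = word_prod u.
Proof. by move=> /sortableE [K [[/reduced_wordE [<- _] _] _]]; exists (factor_word c K). Qed.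

(** [sortable_skip] and [sortable_use] are the two rules of [run], so both sides obey the same
    recursion. *)
Lemma sortable_run c u : uniq c -> sortable alpha c (word_prod u) <->
  exists x, run d c (ap u a) x /\ word_prod x = word_prod u.
Proof.
move=> uc; move: (@regular_apa _ _ d u); move e : (ap u a) => y ry.
move: c y uc ry u e; apply: rotation_ind =>
  [y _ u _|s c y sc uc ry hs IH u e|s c y sc uc ry hs IH u e].
- split=> [/sortableE [K [[/reduced_wordE [h _] _] _]]|[x [/run_nil -> <-]]].
    exists [::]; split; first exact: RunNil.
    by rewrite -h; congr word_prod; elim: (K).
  apply/sortableE; exists [::]; split; last by move=> i; rewrite !nth_nil.
  split; first by apply/reduced_wordE; split=> //; rewrite /red /ap /= ninv_a.
  by move=> K' _; rewrite factor_positions_nil.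
- rewrite sortable_skip // ?apE ?e // (IH u e).
  split=> -[x [h ex]]; exists x; split=> //; first exact: RunSkip.
  exact: run_skip h.
- rewrite sortable_use // ?apE ?e //; last by exists u.
  have -> : reflection (alpha s) *m word_prod u = word_prod (s :: u).
    by rewrite /word_prod big_cons.
  rewrite (IH (s :: u)); last by rewrite ap_cons e.
  split=> [[x [h ex]]|[x [/(run_use hs) [x' -> h] ex]]].
    exists (s :: x); split; first exact: RunUse.
    by apply/word_prod_eq => z; rewrite ap_cons ((word_prod_eq _ _ _).1 ex) ap_cons rfK.
  exists x'; split=> //; apply/word_prod_eq => z.
  by rewrite ap_cons -((word_prod_eq _ _ _).1 ex) ap_cons rfK.
Qed.

End Sortable.

(** * Cones, faces and rays of the Cambrian fan *)

Section CambrianCones.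
Variables (R : realType) (n : nat) (d : root_datum R n).
Local Notation V := 'cV[R]_n.
Local Notation alpha := (rd_alpha d).
Local Notation v := (rd_v d).
Local Notation a := (rd_a d).
Local Notation roots := (rd_roots d).
Local Notation sf s := (rf (alpha s)).
Implicit Types (b y z g f : V) (s t r : 'I_n) (c u : seq 'I_n) (B P N : seq V).
Local Notation cambrian := (cambrian d).
Local Notation ap := (ap d).
Local Notation word_prod := (word_prod alpha).

Lemma pi_down_run c u x w : uniq c -> run d c (ap u a) x ->
  pi_down alpha c (word_prod u) w <-> w = word_prod x.
Proof.
move=> uc h; have hx := run_idem uc (@regular_apa _ _ d u) h.
have sx : sortable alpha c (word_prod x) by apply/sortable_run => //; exists x.
have xu := run_weak_le h.
have mx w' : sortable alpha c w' -> right_weak_le alpha w' (word_prod u) ->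
    right_weak_le alpha w' (word_prod x).
  move=> sw'; have [u1 e1] := sortable_word sw'; rewrite {}e1 in sw' *.
  have [x1 [h1 e1]] := (sortable_run d u1 uc).1 sw'; rewrite -e1 => le.
  by apply: (run_max uc h) le; rewrite ((word_prod_eq _ _ _).1 e1).
split=> [[sw wu mw]|->]; last by split.
by apply: weak_le_antisym; [exact: mx|exact: mw].
Qed.

Lemma dominant_pos y b : fundamental_chamber alpha y -> b \in roots -> 0 < dot a b ->
  0 <= dot y b.
Proof.
move=> hy bR bp; rewrite (dot_expand d); apply: sumr_ge0 => s _; apply: mulr_ge0 => //.
by rewrite dotC root_pos_coef.
Qed.

Lemma cambrian_coneE c u x P N : uniq c -> run d c (ap u a) x ->
  cambrian c P N -> icone (P ++ N) (ap u a) ->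
  cambrian_cone alpha c (word_prod x) = [set z | cone (P ++ N) z].
Proof.
move=> uc h C hu; apply/seteqP; split=> z.
  move=> [_ [[u' _ <-]]]; have [x' h'] := run_exists uc (@regular_apa _ _ d u').
  move=> /(pi_down_run _ uc h') /word_prod_eq ex [y hy <-] b bB.
  have [P' [N' [C' hu' _]]] := cambrian_exists uc (@regular_apa _ _ d u').
  have e : P ++ N =i P' ++ N'.
    apply: (cambrian_unique uc (@regular_apa _ _ d x) C C').
      exact: (run_icone uc (@regular_apa _ _ d u) h).
    rewrite ex; exact: (run_icone uc (@regular_apa _ _ d u') h').
  rewrite apE ap_adj; apply: dominant_pos => //.
    by rewrite ap_root (cam_root C).
  by rewrite -ap_adj hu' // -e.
(* Perturbing z towards [ap u a] gives a chamber inside the cone even when z is on its boundary, and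
   z belongs to the closed chamber. *)
move=> /= hz; have [u' [h1 h2]] := chamber_near z (@regular_apa _ _ d u).
have hu' : icone (P ++ N) (ap u' a).
  move=> b bB; have bR := cam_root C bB; have := hz b bB.
  rewrite le_eqVlt => /orP[/eqP e|]; last exact: h1.
  by apply: h2 => //; exact: hu.
have [x' h'] := run_exists uc (@regular_apa _ _ d u').
have ex := run_same uc (@regular_apa _ _ d u) (@regular_apa _ _ d u') C hu hu' h h'.
exists (word_prod u'); first by split; [exists u'|apply/(pi_down_run _ uc h'); rewrite ex].
exists (ap (rev u') z); last by rewrite apE apK.
move=> s; rewrite ap_adj revK leNgt; apply/negP => hs.
have := h1 (- ap u' (alpha s)); rewrite rootNE ap_root alpha_root !dotNr !oppr_gt0.
by move=> /(_ isT hs); rewrite ap_iso ltNge ltW // alpha_pos.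
Qed.

Definition full c := uniq c /\ forall s, s \in c.

Lemma coxeter_full c : coxeter_word c -> full c.
Proof.
move=> h; split; first by rewrite (perm_uniq h) enum_uniq.
by move=> s; rewrite (perm_mem h) mem_enum.
Qed.

Lemma full_rcons s c : full (s :: c) -> full (rcons c s).
Proof.
by move=> [/= /andP[sc uc] h]; split=> [|r]; rewrite ?rcons_uniq ?sc // mem_rcons.
Qed.

Lemma full_notin s c : full (s :: c) -> s \notin c.
Proof. by move=> [/= /andP[]]. Qed.

Lemma full_span c P N z : full c -> cambrian c P N ->
  {in P ++ N, forall b, dot z b = 0} -> z = 0.
Proof. by move=> [_ fc] C h; apply: (@alpha_span _ _ d) => s; exact: (cam_span C h). Qed.

Definition ray_of B g := exists2 b, b \in B & dual_vector B b g.

Lemma dual_unique c P N b g g' : full c -> cambrian c P N ->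
  dual_vector (P ++ N) b g -> dual_vector (P ++ N) b g' -> g = g'.
Proof.
move=> fc C [g1 g2] [h1 h2]; apply/eqP; rewrite -subr_eq0; apply/eqP.
apply: (full_span fc C) => x xB; rewrite dotBl.
by have [->|ne] := eqVneq x b; rewrite ?g1 ?h1 ?g2 ?h2 ?subrr.
Qed.

Lemma ray_cone B g : ray_of B g -> cone B g.
Proof.
move=> [b bB [g1 g2]] x xB.
by have [->|ne] := eqVneq x b; rewrite ?g1 ?ler01 // g2.
Qed.

Lemma ray_of_eq B B' g : B =i B' -> ray_of B g -> ray_of B' g.
Proof.
by move=> e [b bB h]; exists b; [rewrite -e|exact: dual_vector_eq h].
Qed.

Section Expansion.
Variables (c : seq 'I_n) (P N : seq V) (G : V -> V).
Hypotheses (fc : full c) (C : cambrian c P N)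
  (GP : {in P ++ N, forall b, dual_vector (P ++ N) b (G b)}).

Lemma expand_rays z : z = \sum_(b <- P ++ N) dot z b *: G b.
Proof.
apply/eqP; rewrite -subr_eq0; apply/eqP; apply: (full_span fc C) => b bB.
rewrite dotBl dot_suml (bigD1_seq b) ?(cam_uniq C) //= dotZl (GP bB).1 mulr1.
rewrite big_seq_cond big1 ?addr0 ?subrr // => x /andP[xB xb].
by rewrite dotZl (GP xB).2 ?mulr0 // eq_sym.
Qed.

Lemma expand_roots z : z = \sum_(b <- P ++ N) dot z (G b) *: b.
Proof.
set z' := \sum_(b <- _) _; apply/eqP; rewrite -subr_eq0 -dot_eq0; apply/eqP.
rewrite {1}(expand_rays (z - z')) dot_suml big_seq big1 // => b bB.
rewrite dotZl; suff -> : dot (G b) (z - z') = 0 by rewrite mulr0.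
rewrite dotBr dot_sumr (bigD1_seq b) ?(cam_uniq C) //= dotZr (GP bB).1 mulr1.
rewrite big_seq_cond big1 ?addr0 => [|x /andP[xB xb]]; first by rewrite dotC subrr.
by rewrite dotZr (GP bB).2 ?mulr0.
Qed.

End Expansion.

Lemma ray_face c P N g : full c -> cambrian c P N -> ray_of (P ++ N) g ->
  cone_face [set z | cone (P ++ N) z] (ray g).
Proof.
move=> fc C [b bB [g1 g2]].
exists (\sum_(x <- P ++ N | x != b) x); split=> [z hz|].
  by rewrite dot_suml big_seq_cond; apply: sumr_ge0 => x /andP[xB _]; rewrite dotC hz.
apply/seteqP; split=> z /=.
  move=> [t /= t0 <-]; split.
    move=> x xB; rewrite dotZl mulr_ge0 //.
    by apply: (@ray_cone (P ++ N)) => //; exists b.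
  rewrite dot_suml big_seq_cond big1 // => x /andP[xB xb].
  by rewrite dotZr dotC g2 ?mulr0.
move=> [hz]; rewrite dot_suml big_seq_cond => /eqP.
rewrite psumr_eq0 => [/allP h|x /andP[xB _]]; last by rewrite dotC hz.
exists (dot z b); first exact: hz.
apply/eqP; rewrite -subr_eq0; apply/eqP; apply: (full_span fc C) => x xB.
have [->|xb] := eqVneq x b; rewrite dotBl dotZl ?g1 ?mulr1 ?subrr //.
by have := h x xB; rewrite xB xb /= => /eqP; rewrite dotC => ->; rewrite g2 // mulr0 subrr.
Qed.

Lemma face_ray c P N z : full c -> cambrian c P N -> z != 0 ->
  cone_face [set y | cone (P ++ N) y] (ray z) ->
  exists2 g, ray_of (P ++ N) g & ray z = ray g.
Proof.
move=> fc C z0 [f [hf eF]]; have [G GP] := cambrian_dual_fun C.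
have Gray b : b \in P ++ N -> ray_of (P ++ N) (G b) by move=> bB; exists b => //; exact: GP.
have : ray z z by exists 1; rewrite /= ?ler01 ?scale1r.
rewrite {1}eF => -[/= hz fz].
have [b bB zb] : exists2 b, b \in P ++ N & dot z b != 0.
  apply: contrapT => hn; case/eqP: z0; apply: (full_span fc C) => b bB.
  by apply/eqP; apply: contraT => h; case: hn; exists b.
(* The value of f at z is zero and a sum of nonnegative terms, and [G b] has a nonzero coefficient
   in z. So [G b] lies in the face, which is the ray of z. *)
have fG : dot f (G b) = 0.
  have : \sum_(x <- P ++ N) dot z x * dot f (G x) = 0.
    transitivity (dot f (\sum_(x <- P ++ N) dot z x *: G x)); last first.
      by rewrite -(expand_rays fc C GP z).
    by rewrite dot_sumr; apply: eq_bigr => x _; rewrite dotZr.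
  rewrite big_seq => /eqP; rewrite psumr_eq0 => [/allP /(_ b bB)|x xB]; last first.
    by rewrite mulr_ge0 ?hz ?hf //; apply/ray_cone/Gray.
  by rewrite bB /= mulf_eq0 (negPf zb) /= => /eqP.
exists (G b); first exact: Gray.
have : ray z (G b) by rewrite eF; split=> //=; apply/ray_cone/Gray.
move=> [t /= t0 tz]; have tp : 0 < t.
  rewrite lt_def t0 andbT; apply: contra_eqN (GP _ bB).1 => /eqP e.
  by rewrite -tz e scale0r dot0l eq_sym oner_eq0.
apply/seteqP; split=> y [k /= k0 <-].
  exists (k / t); first by rewrite /= divr_ge0.
  by rewrite -tz scalerA divfK // gt_eqF.
by exists (k * t); rewrite /= ?mulr_ge0 // -tz scalerA.
Qed.

Lemma cambrian_rayP c rho : full c -> cambrian_rays alpha c rho ->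
  exists P N g, [/\ cambrian c P N, ray_of (P ++ N) g & rho = ray g].
Proof.
move=> fc [[w [sw]]]; have [u e] := sortable_word sw; rewrite {}e in sw *.
have [uc _] := fc; have [x [h ex]] := (sortable_run d u uc).1 sw.
have [P [N [C hu _]]] := cambrian_exists uc (@regular_apa _ _ d u).
rewrite -ex (cambrian_coneE uc h C hu) => hface [z z0 ez].
rewrite ez in hface *; have [g gr eg] := face_ray fc C z0 hface.
by exists P, N, g.
Qed.

Lemma ray_cambrian c u P N g : full c -> cambrian c P N -> icone (P ++ N) (ap u a) ->
  ray_of (P ++ N) g -> cambrian_rays alpha c (ray g).
Proof.
move=> fc C hu gr; have [uc _] := fc.
have [x h] := run_exists uc (@regular_apa _ _ d u); split; last first.
  exists g => //; case: gr => b _ [g1 _]; apply: contra_eq_neq g1 => ->.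
  by rewrite dot0l eq_sym oner_neq0.
exists (word_prod x); split.
  by apply/sortable_run => //; exists x; split=> //; exact: (run_idem uc (@regular_apa _ _ d u) h).
by rewrite (cambrian_coneE uc h C hu); exact: (ray_face fc C gr).
Qed.

End CambrianCones.

(** * Heights on rays and the vertices of the associahedron *)

Section Polytope.
Variables (R : realType) (n : nat) (d : root_datum R n).
Local Notation V := 'cV[R]_n.
Local Notation alpha := (rd_alpha d).
Local Notation v := (rd_v d).
Local Notation a := (rd_a d).
Local Notation roots := (rd_roots d).
Local Notation sf s := (rf (alpha s)).
Implicit Types (b y z g f : V) (s t r : 'I_n) (c u : seq 'I_n) (B P N : seq V) (h : V -> R).
Local Notation cambrian := (cambrian d).
Local Notation ap := (ap d).
Local Notation word_prod := (word_prod alpha).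

Lemma apZ u k z : ap u (k *: z) = k *: ap u z.
Proof. by elim: u => //= s u IH; rewrite !ap_cons IH rfZ. Qed.

Definition vertex_of h B x := forall g, ray_of B g -> dot x g = h g.

(* Convexity of the piecewise linear function on the fan with values h on the rays. *)
Definition convex_on c h := forall P N P' N' x g, cambrian c P N -> cambrian c P' N' ->
  vertex_of h (P ++ N) x -> ray_of (P' ++ N') g -> dot x g <= h g.

Lemma vertex_of_exists c P N h : full c -> cambrian c P N -> exists x, vertex_of h (P ++ N) x.
Proof.
move=> fc C; have [G GP] := cambrian_dual_fun C.
exists (\sum_(b <- P ++ N) h (G b) *: b) => g [b bB gd].
rewrite (dual_unique fc C gd (GP _ bB)) dot_suml (bigD1_seq b) ?(cam_uniq C) //=.
rewrite dotZl dotC (GP _ bB).1 mulr1 big_seq_cond big1 ?addr0 // => x /andP[xB xb].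
by rewrite dotZl dotC (GP _ bB).2 ?mulr0.
Qed.

Lemma vertex_of_unique c P N h x x' : full c -> cambrian c P N ->
  vertex_of h (P ++ N) x -> vertex_of h (P ++ N) x' -> x = x'.
Proof.
move=> fc C hx hx'; have [G GP] := cambrian_dual_fun C.
rewrite (expand_roots fc C GP x) (expand_roots fc C GP x') big_seq [RHS]big_seq.
apply: eq_bigr => b bB; congr (_ *: _).
have gr : ray_of (P ++ N) (G b) by exists b => //; exact: GP.
by rewrite hx // hx'.
Qed.

Lemma vertex_of_eq B B' h x : B =i B' -> vertex_of h B x -> vertex_of h B' x.
Proof. by move=> e hx g gr; apply: hx; apply: ray_of_eq gr => b; rewrite e. Qed.

(** The sum of the dual vectors takes the value 1 on every member, hence is interior to the cone. *)
Lemma realize c P N : full c -> cambrian c P N -> exists u, icone (P ++ N) (ap u a).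
Proof.
move=> fc C; have [G GP] := cambrian_dual_fun C.
pose z := \sum_(b <- P ++ N) G b.
have [u [h1 _]] := chamber_near z (@regular_a _ _ d); exists u => b bB.
apply: h1; first exact: (cam_root C).
rewrite /z dot_suml (bigD1_seq b) ?(cam_uniq C) //= (GP _ bB).1.
rewrite big_seq_cond big1 ?addr0 ?ltr01 // => x /andP[xB xb].
by rewrite (GP _ xB).2 // eq_sym.
Qed.

(** Since g is orthogonal to b, adding multiples of b to the other members does not change their
    values on g. The two cones thus share every ray except the one dual to b. *)
Lemma flip_ray c P' N' b g b0 B (D : seq (V * R)) : cambrian c P' N' ->
  B =i b :: [seq e.1 | e <- D] -> P' ++ N' =i - b :: [seq e.1 + e.2 *: b | e <- D] ->
  b \in B -> b0 \in B -> b0 != b -> dual_vector B b0 g -> ray_of (P' ++ N') g.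
Proof.
move=> C' e1 e2 bB b0B ne [g1 g2].
have gb : dot g b = 0 by apply: g2 => //; rewrite eq_sym.
have /mapP[e eD eb0] : b0 \in [seq e.1 | e <- D].
  by move: b0B; rewrite e1 inE (negPf ne).
have b1B : b0 + e.2 *: b \in P' ++ N'.
  by rewrite e2 inE; apply/orP; right; apply/mapP; exists e; rewrite // eb0.
exists (b0 + e.2 *: b) => //; split; first by rewrite dotDr dotZr gb mulr0 addr0.
move=> x xB; have := xB; rewrite e2 inE => /orP[/eqP->|/mapP[e' e'D ->]] xne.
  by rewrite dotNr gb oppr0.
rewrite dotDr dotZr gb mulr0 addr0.
(* The list D might pair b0 with two different multiples of b; the independence of P' and N'
   excludes this. *)
have [ee|nee] := eqVneq e'.1 b0; last first.
  by apply: g2 => //; rewrite e1 inE; apply/orP; right; apply/mapP; exists e'.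
have xB' : b0 + e'.2 *: b \in P' ++ N'.
  by rewrite e2 inE; apply/orP; right; apply/mapP; exists e'; rewrite // ee.
rewrite ee in xne; have [g' [h1 h2]] := cam_dual C' xB'.
have nbB : - b \in P' ++ N' by rewrite e2 mem_head.
have [eqb|neb] := eqVneq (- b) (b0 + e'.2 *: b).
  have : dot g (b0 + e'.2 *: b) = 0 by rewrite -eqb dotNr gb oppr0.
  by rewrite dotDr dotZr gb mulr0 addr0 ee.
have g'b : dot g' b = 0.
  by have /eqP := h2 _ nbB neb; rewrite dotNr oppr_eq0 => /eqP.
have : dot g' (b0 + e.2 *: b) = 0 by apply: h2; rewrite // eq_sym.
by have := h1; rewrite !dotDr !dotZr g'b !mulr0 !addr0 => -> /eqP; rewrite oner_eq0.
Qed.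

Lemma flip_vertex c P N P' N' b (D : seq (V * R)) h x x' : full c ->
  cambrian c P N -> cambrian c P' N' ->
  P ++ N =i b :: [seq e.1 | e <- D] -> P' ++ N' =i - b :: [seq e.1 + e.2 *: b | e <- D] ->
  vertex_of h (P ++ N) x -> vertex_of h (P' ++ N') x' ->
  exists2 g, dual_vector (P ++ N) b g & x' = x - (h g - dot x' g) *: b.
Proof.
move=> fc C C' e1 e2 hx hx'; have [G GP] := cambrian_dual_fun C.
have bB : b \in P ++ N by rewrite e1 mem_head.
exists (G b); first exact: GP.
have gr b' : b' \in P ++ N -> ray_of (P ++ N) (G b') by move=> b'B; exists b' => //; exact: GP.
suff : x - x' = (h (G b) - dot x' (G b)) *: b by move=> <-; rewrite subKr.
rewrite [LHS](expand_roots fc C GP) (bigD1_seq b) ?(cam_uniq C) //=.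
rewrite big_seq_cond big1 ?addr0 => [|b' /andP[b'B ne]].
  by rewrite dotBl hx //; exact: gr.
rewrite dotBl hx ?hx' ?subrr ?scale0r //; last exact: gr.
exact: (flip_ray C' e1 e2 bB b'B ne (GP _ b'B)).
Qed.

(** Convexity, applied to x' and the ray of the first cone dual to b, gives the sign of the multiple
    in [flip_vertex]. *)
Lemma edge_vertex c y y' b P N P' N' h x x' : full c -> convex_on c h -> adjacent d y y' b ->
  cambrian c P N -> cambrian c P' N' -> icone (P ++ N) y -> icone (P' ++ N') y' ->
  vertex_of h (P ++ N) x -> vertex_of h (P' ++ N') x' ->
  exists2 m, 0 <= m & x' = x - m *: b.
Proof.
move=> fc hh A C C' hy hy' hx hx'.
have [[e|[D [e1 e2]]] _] := cambrian_edge fc.1 (adj_reg A) A C C' hy hy'.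
  exists 0 => //; rewrite scale0r subr0; apply: (vertex_of_unique fc C' hx').
  exact: vertex_of_eq e hx.
have [g gd xE] := flip_vertex fc C C' e1 e2 hx hx'; exists (h g - dot x' g) => //.
rewrite subr_ge0; apply: (hh _ _ _ _ _ _ C' C hx').
by exists b => //; rewrite e1 mem_head.
Qed.

(** The walls crossed on the way from the dominant chamber to u are inversions of u, where z is
    nonnegative, and each crossing subtracts a nonnegative multiple of such a root. *)
Lemma path_vertex c h u : full c -> convex_on c h -> red d u ->
  forall P N P0 N0 x x0, cambrian c P N -> cambrian c P0 N0 ->
  icone (P ++ N) (ap u a) -> icone (P0 ++ N0) a ->
  vertex_of h (P ++ N) x -> vertex_of h (P0 ++ N0) x0 ->
  forall z, (forall g, g \in roots -> 0 < dot a g -> dot (ap u a) g < 0 -> 0 <= dot z g) ->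
  dot x z <= dot x0 z.
Proof.
move=> fc hh; elim/last_ind: u => [|u t IH] r P N P0 N0 x x0 C C0 hu h0 hx hx0 z hz.
  rewrite (vertex_of_unique fc C hx (vertex_of_eq _ hx0)) //.
  exact: (cambrian_unique fc.1 (@regular_a _ _ d) C0 C).
have [ru _] : red d u /\ red d [:: t] by apply: red_cat; rewrite cats1.
have A := adjacent_red r.
have [Q [M [CQ hQ _]]] := cambrian_exists fc.1 (@regular_apa _ _ d u).
have [x1 hx1] := vertex_of_exists h fc CQ.
have [m m0 ->] := edge_vertex fc hh A CQ C hQ hu hx1 hx.
have h1 : dot x1 z <= dot x0 z.
  apply: (IH ru _ _ _ _ _ _ CQ C0 hQ h0 hx1 hx0) => g gR gp hg; apply: hz => //.
  rewrite (regular_neg (adj_reg' A)) // -(adj_other A) //.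
    by rewrite -leNgt ltW.
  by apply: contraTneq hg => ->; rewrite -leNgt ltW // (adj_y A).
rewrite dotBl dotZl; have := hz _ (adj_root A) (adj_pos A) (adj_y' A).
by rewrite dotC => /(mulr_ge0 m0); lra.
Qed.

Lemma cambrian_simple c : uniq c -> cambrian c (map alpha c) [::].
Proof.
elim: c => [_|s c IH /= /andP[sc uc]]; first exact: cambrian_nil.
by apply: cambrian_unpeel => //; exact: IH.
Qed.

Lemma simple_ray c s g : full c -> dual_vector (map alpha c ++ [::]) (alpha s) g -> g = v s.
Proof.
move=> fc gd; apply: (dual_unique fc (cambrian_simple fc.1) gd); split.
  by rewrite dot_v_alpha eqxx.
move=> b; rewrite cats0 => /mapP[r _ ->]; rewrite (inj_eq (@alpha_inj _ _ d)) => rs.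
by rewrite dot_v_alpha eq_sym (negPf rs).
Qed.

Lemma v_notin_cone c s P N : s \notin c -> cambrian (s :: c) P N -> alpha s \notin P ->
  ~ cone (P ++ N) (v s).
Proof.
move=> sc C sP /(neg_on_initial sc C sP); rewrite dot_v_alpha eqxx.
by rewrite ler10.
Qed.

Lemma mutate_pairs c s P N : s \notin c -> cambrian c P N ->
  exists P' N' (D : seq (V * R)), [/\ cambrian (s :: c) P' N',
    alpha s :: (P ++ N) =i alpha s :: [seq e.1 | e <- D] &
    P' ++ N' =i - alpha s :: [seq e.1 + e.2 *: alpha s | e <- D]].
Proof.
move=> sc C; have [P' [N' [C' e]]] := cambrian_mutate_neg sc C.
pose k x := - (2 * dot x (alpha s) / dot (alpha s) (alpha s)).
exists P', N', ([seq (p, k p) | p <- P] ++ [seq (q, 0) | q <- N]); split=> // x.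
  by rewrite map_cat -!map_comp /= !map_id.
rewrite e map_cat -!map_comp /= !inE !mem_cat; congr [|| _, _ | _].
  by apply/mapP/mapP => -[p pP ->]; exists p => //=; rewrite /rf /k scaleNr.
by rewrite (@eq_map _ _ _ id) ?map_id // => q /=; rewrite scale0r addr0.
Qed.

(** If [alpha s] is not in P, rotation carries the whole cone. Otherwise g is orthogonal to
    [alpha s], so s fixes it, and it is a ray of the family given by [cambrian_mutate]. *)
Lemma ray_rot c s P N g : full (s :: c) -> cambrian (s :: c) P N -> ray_of (P ++ N) g ->
  g != v s -> dot g (alpha s) <= 0 /\
  exists P' N', cambrian (rcons c s) P' N' /\ ray_of (P' ++ N') (sf s g).
Proof.
move=> fc C gr gs; have sc := full_notin fc.
have [sP|sP] := boolP (alpha s \in P); last first.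
  split; first by apply: (neg_on_initial sc C sP); exact: ray_cone.
  have [P' [N' [C' e]]] := cambrian_rot sc C sP; exists P', N'; split=> //.
  case: gr => b bB gd; exists (sf s b); first by rewrite e map_f.
  by apply: dual_vector_eq (dual_vector_map d s gd) => x; rewrite e.
have [P1 C1 e1] := cambrian_peel sc C sP; case: gr => b bB [g1 g2].
have co x : x \in P1 ++ N -> dot (v s) x = 0 by move=> xB; apply: (cam_supp C1).
have v1 : dot (v s) (alpha s) = 1 by rewrite dot_v_alpha eqxx.
have bs : b != alpha s.
  apply: contraNneq gs => eb; apply/eqP.
  apply: (dual_unique (b := b) fc C); first by split.
  rewrite eb; split=> // x; rewrite e1 inE => /orP[->//|xB] _; exact: co.
have g0 : dot g (alpha s) = 0 by apply: g2; rewrite ?e1 ?mem_head // eq_sym.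
split; first by rewrite g0.
exists (rcons P1 (alpha s)), (map (sf s) N); split; first exact: cambrian_mutate.
rewrite rf_id //.
have gsf x : dot g (sf s x) = dot g x by rewrite -rf_adj rf_id.
have PN x : x \in P1 -> x \in N -> False.
  have := cam_uniq C1; rewrite cat_uniq => /and3P[_ /hasPn h _] xP xN.
  by have := h _ xN; rewrite /= xP.
have sub x : x \in P1 ++ N -> x \in P ++ N by move=> xB; rewrite e1 inE xB orbT.
have bB1 : b \in P1 ++ N by move: bB; rewrite e1 inE (negPf bs).
have key b' : b' \in rcons P1 (alpha s) ++ map (sf s) N -> dot g b' = 1 ->
    (forall x, x \in P1 -> x != b' -> x != b) -> (forall x, x \in N -> sf s x != b' -> x != b) ->
    ray_of (rcons P1 (alpha s) ++ map (sf s) N) g.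
  move=> b'B gb' k1 k2; exists b' => //; split=> // x.
  rewrite mem_cat mem_rcons inE => /orP[/orP[/eqP->//|xP]|/mapP[x' x'N ->]] ne.
    by apply: g2; [apply: sub; rewrite mem_cat xP|exact: k1].
  by rewrite gsf; apply: g2; [apply: sub; rewrite mem_cat x'N orbT|exact: k2].
move: bB1; rewrite mem_cat => /orP[bP|bN].
  apply: (key b) => //; first by rewrite mem_cat mem_rcons inE bP orbT.
  by move=> x xN _; apply/eqP => xb; apply: (PN b); rewrite // -xb.
apply: (key (sf s b)); rewrite ?gsf //.
- by rewrite mem_cat map_f ?orbT.
- by move=> x xP _; apply/eqP => xb; apply: (PN b); rewrite // -xb.
- by move=> x xN; apply: contraNneq => ->.
Qed.

Definition next_height s h g := if g == v s then dot a (v s) else h (sf s g).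

(** This is the inequality for the new ray. After applying s, a gallery for c s leads from the
    dominant chamber, with vertex a, to a chamber without the inversion [alpha s]; so [sf s (v s)]
    is nonnegative on all inversions met. This bounds [dot x (v s)] by the value of a at
    [sf s (v s)], which is at most that at [v s]. *)
Lemma next_height_initial c s h P N x : full (s :: c) -> convex_on (rcons c s) h ->
  (forall r, h (v r) = dot a (v r)) -> cambrian (s :: c) P N -> alpha s \notin P ->
  vertex_of (next_height s h) (P ++ N) x -> dot x (v s) <= dot a (v s).
Proof.
move=> fc hh hv C sP hx; have sc := full_notin fc; have fc' := full_rcons fc.
have [Q [M [C' e]]] := cambrian_rot sc C sP.
have hx' : vertex_of h (Q ++ M) (sf s x).
  move=> g gr; have gr' : ray_of (P ++ N) (sf s g).
    case: gr => b; rewrite e => /mapP[b' b'B ->] gd; exists b' => //.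
    have := dual_vector_map d s gd; rewrite rfK; apply: dual_vector_eq => y.
    by rewrite mem_map_rf e mem_map_rf rfK.
  rewrite rf_adj hx // /next_height ifN ?rfK //.
  apply/eqP => es; apply: (v_notin_cone sc C sP); rewrite -es; exact: ray_cone.
have [u0 hu0] := realize fc' C'; have [u ru eu] := red_exists d u0.
have hu : icone (Q ++ M) (ap u a) by rewrite eu.
have us : 0 < dot (ap u a) (alpha s).
  have : cone (P ++ N) (sf s (ap u a)).
    by apply: icone_cone; apply/icone_map; apply: icone_eq e _.
  move=> /(neg_on_initial sc C sP); rewrite rf_adj sf_alpha dotNr oppr_le0 => us.
  by rewrite lt_def us andbT (regular_apa (d := d)) ?alpha_root.
have ha : icone (map alpha (rcons c s) ++ [::]) a.
  by move=> b; rewrite cats0 => /mapP[r _ ->]; exact: alpha_pos.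
have va : vertex_of h (map alpha (rcons c s) ++ [::]) a.
  move=> g [b]; rewrite {1}cats0 => /mapP[r _ ->] /(simple_ray fc') ->.
  by rewrite hv.
have := path_vertex fc' hh ru C' (cambrian_simple fc'.1) hu ha hx' va.
move=> /(_ (sf s (v s))); rewrite rf_iso => h1.
apply: le_trans (h1 _) _.
  move=> g gR gp hg; rewrite rf_adj; apply: root_pos_coef; rewrite ?sf_root //.
  by apply: sf_pos => //; apply: contraTneq hg => ->; rewrite -leNgt ltW.
rewrite -subr_ge0 -dotBr v_sub_sf dotZr mulr_ge0 ?(ltW (alpha_pos d s)) //.
by rewrite divr_ge0 // dot_ge0.
Qed.

Lemma convex_next c s h : full (s :: c) -> convex_on (rcons c s) h ->
  (forall r, h (v r) = dot a (v r)) -> convex_on (s :: c) (next_height s h).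
Proof.
move=> fc hh hv P N P' N' x g C C' hx gr; have sc := full_notin fc.
have rotv P0 N0 x0 : cambrian (s :: c) P0 N0 -> alpha s \notin P0 ->
    vertex_of (next_height s h) (P0 ++ N0) x0 -> g != v s -> dot x0 g <= h (sf s g).
  move=> C0 sP0 hx0 gs; have [_ [Q' [M' [CQ' gQ']]]] := ray_rot fc C' gr gs.
  have [Q [M [CQ e]]] := cambrian_rot sc C0 sP0.
  rewrite -(rf_iso (alpha s)); apply: (hh _ _ _ _ _ _ CQ CQ') => // g' gr'.
  have gr0 : ray_of (P0 ++ N0) (sf s g').
    case: gr' => b; rewrite e => /mapP[b' b'B ->] gd; exists b' => //.
    have := dual_vector_map d s gd; rewrite rfK; apply: dual_vector_eq => y.
    by rewrite mem_map_rf e mem_map_rf rfK.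
  rewrite rf_adj hx0 // /next_height ifN ?rfK //.
  apply/eqP => es; apply: (v_notin_cone sc C0 sP0); rewrite -es; exact: ray_cone.
have [sP|sP] := boolP (alpha s \in P); last first.
  have [->|gs] := eqVneq g (v s); last by rewrite {1}/next_height (negPf gs); exact: rotv C sP hx gs.
  by rewrite /next_height eqxx; exact: next_height_initial hh hv C sP hx.
have [P1 C1 e1] := cambrian_peel sc C sP.
have v1 : dot (v s) (alpha s) = 1 by rewrite dot_v_alpha eqxx.
have vd : dual_vector (P ++ N) (alpha s) (v s).
  split=> // y; rewrite e1 inE => /orP[->//|yB] _; exact: (cam_supp C1).
have xv : dot x (v s) = dot a (v s).
  have /hx : ray_of (P ++ N) (v s) by exists (alpha s) => //; rewrite e1 mem_head.
  by rewrite /next_height eqxx.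
have [gs|gs] := eqVneq g (v s); first by rewrite gs xv /next_height eqxx.
have [P2 [N2 [D [C2 e2 e3]]]] := mutate_pairs sc C1.
have [x2 hx2] := vertex_of_exists (next_height s h) fc C2.
have e4 : P ++ N =i alpha s :: [seq e.1 | e <- D] by move=> y; rewrite e1 e2.
have [g' g'd xE] := flip_vertex fc C C2 e4 e3 hx hx2.
have sP2 : alpha s \notin P2.
  have [b0] := realize fc C2 => hb; apply: (initial_desc hb).
  have := hb (- alpha s); rewrite e3 mem_head dotNr oppr_gt0; exact.
(* This bound makes x equal to x2 plus a nonnegative multiple of [alpha s], and g is nonpositive on
   [alpha s]. *)
have h2 := next_height_initial fc hh hv C2 sP2 hx2.
rewrite (dual_unique fc C g'd vd) {1}/next_height eqxx in xE.
have [g0 _] := ray_rot fc C' gr gs.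
rewrite /next_height (negPf gs); apply: le_trans (rotv _ _ _ C2 sP2 hx2 gs).
rewrite [X in _ <= dot X _]xE dotBl dotZl (dotC (alpha s)).
have : 0 <= dot a (v s) - dot x2 (v s) by rewrite subr_ge0.
by move=> /mulr_ge0_le0 /(_ g0); lra.
Qed.

(** The linear height is placed on the word reached after j rotations, and the rotations are then
    undone. The value 0 for the empty word is a default: its families have no rays. *)
Fixpoint height (j : nat) c g : R :=
  if j is j'.+1 then
    if c is s :: c' then next_height s (height j' (rcons c' s)) g else 0
  else dot a g.

Lemma height_v j c r : full c -> height j c (v r) = dot a (v r).
Proof.
elim: j c => // j IH [|s c] fc; first by have := fc.2 r.
rewrite /= /next_height; case: eqP => [->//|/eqP ne].
rewrite sf_v; first by apply: IH; exact: full_rcons.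
by apply: contraNneq ne => ->.
Qed.

Lemma height_convex j c : full c -> convex_on c (height j c).
Proof.
elim: j c => [|j IH] [|s c] fc.
1,3: by move=> P N P' N' x g _ /cambrian_nil_eq -> _ [b].
- move=> P N P' N' x g C C' hx gr /=.
  by rewrite (vertex_of_unique fc C hx (x' := a)).
- apply: convex_next => //; first by apply: IH; exact: full_rcons.
  by move=> r; apply: height_v; exact: full_rcons.
Qed.

(* Rotating the Coxeter word moves every ray towards the dominant chamber, until it
   becomes the fundamental weight of the initial letter. *)
Lemma height_stable c P N g : full c -> cambrian c P N -> ray_of (P ++ N) g ->
  exists j0 u t, g = ap u (v t) /\ forall j, (j0 <= j)%N -> height j c g = dot a (v t).
Proof.
pose p g := fun r => dot g (alpha r) != 0.
(* If g is negative on [alpha s], rotating removes an inversion of g. Otherwise g is fixed, and the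
   first letter whose simple root is not orthogonal to g moves one place forward. The weight n + 1
   exceeds every value of [find]. *)
have [m] := ubnP (ninv d g * n.+1 + find (p g) c)%N.
elim: m c P N g => // m IH [|s c] P N g hm fc C gr.
  by case: gr => b; rewrite (cambrian_nil_eq C).
have [->|gs] := eqVneq g (v s).
  exists 1%N, [::], s; split=> // -[//|j] _.
  by rewrite /= /next_height eqxx.
have [g0 [P' [N' [C' gr']]]] := ray_rot fc C gr gs; have fc' := full_rcons fc.
have gn0 : g != 0.
  case: gr => b _ [g1 _]; apply: contra_eq_neq g1 => ->.
  by rewrite dot0l eq_sym oner_neq0.
have sz : size (rcons c s) = n.
  have /perm_size -> : perm_eq (rcons c s) (enum 'I_n).
    apply: uniq_perm; rewrite ?enum_uniq //; first by case: fc'.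
    by move=> r; rewrite mem_enum fc'.2.
  by rewrite size_enum_ord.
have hm' : (ninv d (sf s g) * n.+1 + find (p (sf s g)) (rcons c s) < m)%N.
  move: g0; rewrite le_eqVlt => /orP[/eqP g0|g0].
    rewrite rf_id //; move: hm => /=; rewrite /p g0 eqxx /= addnS ltnS -/(p g).
    rewrite -cats1 find_cat; case: ifP => // /hasPn hn; case/eqP: gn0.
    apply: (@alpha_span _ _ d) => r; have := fc.2 r; rewrite inE => /orP[/eqP->//|rc].
    by have := hn r rc; rewrite /p negbK => /eqP.
  have := find_size (p (sf s g)) (rcons c s); rewrite sz.
  by move: hm; rewrite (ninv_desc g0) mulSn; lia.
have [j0 [u [t [eg hj]]]] := IH _ _ _ _ hm' fc' C' gr'.
exists j0.+1, (s :: u), t; split; first by rewrite ap_cons -eg rfK.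
by case=> // j hj0; rewrite /= /next_height (negPf gs) hj.
Qed.

(** Each letter of a reduced word subtracts a nonnegative multiple of a positive root. *)
Lemma dominant_le u s : dot (ap u a) (v s) <= dot a (v s).
Proof.
have [u' r e] := red_exists d u; rewrite -(e a); elim/last_ind: u' r {e} => // u' t IH r.
have [r' _] : red d u' /\ red d [:: t] by apply: red_cat; rewrite cats1.
apply: le_trans (IH r'); have A := adjacent_red r.
rewrite ap_sf_swap /= /rf dotBl dotZl lerBlDr lerDl.
apply: mulr_ge0; last by rewrite dotC root_pos_coef ?(adj_root A) ?(adj_pos A).
by rewrite divr_ge0 ?dot_ge0 // mulr_ge0 // ltW // (adj_y A).
Qed.

Lemma vertices_Ass c x : full c -> in_lattice d a -> vertices (Ass alpha v c a) x ->
  in_lattice d x.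
Proof.
move=> fc aL [xA [f fx]].
have [u [h1 _]] := chamber_near f (@regular_a _ _ d).
have [P [N [C hu BL]]] := cambrian_exists fc.1 (@regular_apa _ _ d u).
have fB : cone (P ++ N) f.
  move=> b bB; rewrite leNgt; apply/negP => fb.
  have := h1 (- b); rewrite rootNE (cam_root C bB) !dotNr !oppr_gt0 => /(_ isT fb).
  by rewrite ltNge ltW // hu.
have [G GP] := cambrian_dual_fun C.
have Gr b : b \in P ++ N -> ray_of (P ++ N) (G b) by move=> bB; exists b => //; exact: GP.
(* One number J of rotations stabilizes the finitely many rays of this cone. Another ray of the fan
   may need more rotations, but xB remains the vertex for every larger number. *)
have [J hJ] : exists J, {in P ++ N, forall b, exists w t, G b = ap w (v t) /\
    forall j, (J <= j)%N -> height j c (G b) = dot a (v t)}.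
  have : {subset P ++ N <= P ++ N} by [].
  elim: {1 3}(P ++ N) => [|b B IH] sub; first by exists 0%N.
  have [|J hJ] := IH; first by move=> y yB; apply: sub; rewrite inE yB orbT.
  have [j0 [w [t [e hj]]]] := height_stable fc C (Gr _ (sub _ (mem_head _ _))).
  exists (maxn J j0) => y; rewrite inE => /orP[/eqP->|/hJ [w' [t' [e' hj']]]].
    by exists w, t; split=> // j; rewrite geq_max => /andP[_]; exact: hj.
  by exists w', t'; split=> // j; rewrite geq_max => /andP[+ _]; exact: hj'.
have [xB hxB] := vertex_of_exists (height J c) fc C.
have hxj j : (J <= j)%N -> vertex_of (height j c) (P ++ N) xB.
  move=> Jj g [b bB gd]; rewrite (dual_unique fc C gd (GP _ bB)) hxB; last exact: Gr.
  by have [w [t [_ h]]] := hJ b bB; rewrite !h.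
have xBG b : b \in P ++ N -> exists w t, G b = ap w (v t) /\ dot xB (G b) = dot a (v t).
  move=> bB; have [w [t [e h]]] := hJ b bB; exists w, t; split=> //.
  by rewrite hxB ?h //; exact: Gr.
have xBL : in_lattice d xB.
  move=> s; rewrite (expand_roots fc C GP xB) dot_suml big_seq; apply: rpred_sum => b bB.
  rewrite dotZl rpredM //; last exact: BL.
  by have [w [t [_ ->]]] := xBG b bB; exact: aL.
have xBA : Ass alpha v c a xB.
  move=> rho /(cambrian_rayP fc) [P' [N' [g [C' gr ->]]]] _ s [w _ <-] eray.
  have [j0 [w0 [t [eg hj]]]] := height_stable fc C' gr.
  have := height_convex (j := maxn J j0) fc C C' (hxj _ (leq_maxl _ _)) gr.
  rewrite hj ?leq_maxr // => hg.
  have : ray g (word_prod w *m v s).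
    by rewrite eray; exists (v s) => //; exists 1; rewrite /= ?ler01 ?scale1r.
  move=> [k /= k0 kg]; rewrite -kg dotZr.
  apply: le_trans (ler_wpM2l k0 hg) _.
  (* The half-space may present the ray by another pair than w0 and t; pulling back by w0 reduces
     the comparison of the two bounds to [dominant_le]. *)
  have := dominant_le (rev (rev w0 ++ w)) s.
  rewrite ap_adj revK ap_cat -(apE d w) -kg -dotZr eg.
  by rewrite apZ ap_revK.
suff -> : x = xB by [].
apply: contrapT => ne; have : dot f xB < dot f x by apply: fx => // e; apply: ne.
rewrite ltNge => /negP; apply.
(* f is a nonnegative combination of the rays of the cone, and on these xB attains the bounds that x
   obeys. *)
rewrite {1 2}(expand_rays fc C GP f) !dot_suml big_seq [X in _ <= X]big_seq.
apply: ler_sum => b bB; rewrite !dotZl; apply: ler_wpM2l; first exact: fB.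
have [w [t [e eb]]] := xBG b bB; rewrite ![dot (G b) _]dotC eb.
have := xA _ (ray_cambrian fc C hu (Gr _ bB)) (word_prod w) t.
rewrite apE -e; apply; first by exists w.
apply/seteqP; split=> z [k k0 <-].
  by exists (k *: v t); [exists k|rewrite apE e apZ].
case: k0 => k' k'0 <-; exists k' => //.
by rewrite apE e apZ.
Qed.

End Polytope.

(** * Lattice coordinates and the permutahedron *)

Section LatticeAndPerm.
Variables (R : realType) (n : nat) (d : root_datum R n).
Local Notation V := 'cV[R]_n.
Local Notation alpha := (rd_alpha d).
Local Notation v := (rd_v d).
Local Notation a := (rd_a d).
Local Notation roots := (rd_roots d).
Local Notation sf s := (rf (alpha s)).

Lemma root_latticeE z : root_lattice alpha z <-> in_lattice d z.
Proof.
split=> [[k ->] t|h].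
  rewrite dot_suml; apply: rpred_sum => s _; rewrite -scaler_int dotZl dotC dot_v_alpha.
  by rewrite rpredM // ?rpred_int ?rpred_nat.
exists (fun s => Num.floor (dot z (v s))); rewrite {1}(expand_alpha d z).
by apply: eq_bigr => s _; rewrite -scaler_int floorK.
Qed.

Lemma in_lattice_ap x z : in_lattice d z -> in_lattice d (ap d x z).
Proof. by move=> hz; elim: x => //= s x IH; apply: in_lattice_sf. Qed.

Lemma vertices_Perm z : in_lattice d a -> vertices (Perm alpha a) z -> in_lattice d z.
Proof.
move=> aL [[m [t [p [t0 t1 pA ez]]]] [f hf]].
have inP i : Perm alpha a (p i).
  exists 1%N, (fun=> 1), (fun=> p i); split=> //; first by rewrite big_ord1.
  by rewrite big_ord1 scale1r.
(* Otherwise f is smaller at every point of the combination than at z, and hence so is the weighted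
   mean, which is its value at z. *)
have [i ei] : exists i, p i = z.
  apply: contrapT => hn.
  have lt i : dot f (p i) < dot f z by apply: hf => // e; apply: hn; exists i.
  have [i ti] : exists i, t i != 0.
    apply: contrapT => hn'; move/eqP: t1; rewrite big1 => [|i _].
      by rewrite eq_sym oner_eq0.
    by apply/eqP; apply: contraT => ti; case: hn'; exists i.
  have : dot f z < dot f z; last by rewrite ltxx.
  rewrite {1}ez dot_sumr -[X in _ < X]mul1r -t1 mulr_suml.
  rewrite [X in X < _](bigD1 i) //= [X in _ < X](bigD1 i) //= ltr_leD //.
    by rewrite dotZr ltr_pM2l // lt_def ti t0.
  by apply: ler_sum => j _; rewrite dotZr ler_wpM2l // ltW.
have [_ [x _ <-] e] := pA i; rewrite -ei -e apE; exact: in_lattice_ap.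
Qed.

End LatticeAndPerm.

(** * From the hypotheses to a root datum *)

Section Construction.
Variables (R : realType) (n : nat) (Phi : set 'cV[R]_n).
Variables (alpha v : 'I_n -> 'cV[R]_n) (a : 'cV[R]_n).
Hypotheses (hPhi : root_system Phi) (hcryst : crystallographic Phi).
Hypotheses (halpha : simple_system Phi alpha) (hv : fundamental_weights alpha v).
Hypothesis haD : (fundamental_chamber alpha)° a.

Lemma interior_dominant s : 0 < dot a (alpha s).
Proof.
have [e /= e0 he] : exists2 e : R, 0 < e & ball a e `<=` fundamental_chamber alpha.
  by move: haD => /nbhs_ballP [e e0 he]; exists e.
have as0 : 0 < dot (alpha s) (alpha s).
  rewrite dot_gt0; apply/eqP => h; apply: (root_neq0 hPhi).
  by rewrite -h; exact: (simple_root halpha).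
(* As m + 1 exceeds every coordinate of [alpha s] in absolute value, moving a by -k [alpha s] stays
   within e in the maximum norm. *)
pose m := \sum_(i < n) `|alpha s i 0|; pose k := e / (m + 1).
have m0 : 0 <= m by apply: sumr_ge0 => i _.
have k0 : 0 < k by rewrite divr_gt0 // ltr_wpDl.
have : ball a e (a - k *: alpha s).
  split=> // i j; rewrite ord1 /ball /= !mxE opprB addrCA subrr addr0.
  rewrite normrM gtr0_norm // /k -mulrA gtr_pMr // mulrC ltr_pdivrMr ?ltr_wpDl // mul1r.
  rewrite (le_lt_trans (y := m)) ?ltrDl ?ltr01 // /m (bigD1 i) //= lerDl.
  by apply: sumr_ge0 => *.
move=> /he /(_ s); rewrite dotBl dotZl subr_ge0; apply: lt_le_trans.
by rewrite mulr_gt0.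
Qed.

Lemma simple_span z : (forall s, dot z (alpha s) = 0) -> z = 0.
Proof.
move=> h; apply/eqP; rewrite -dot_eq0; apply/eqP.
have hz : z \in <<codom_tuple alpha>>%VS.
  by rewrite (span_basis (simple_basis halpha)) memvf.
rewrite {2}(coord_span hz) dot_sumr big1 // => i _; rewrite dotZr.
have /codomP [s ->] : (codom_tuple alpha)`_i \in codom alpha.
  by apply: mem_nth; rewrite size_tuple.
by rewrite h mulr0.
Qed.

Lemma root_datum_exists : exists d : root_datum R n,
  [/\ rd_alpha d = alpha, rd_v d = v & rd_a d = a].
Proof.
have [rs Prs] := (finite_seqP _).1 (root_finite hPhi).
have memE b : b \in undup rs <-> Phi b by rewrite mem_undup Prs.
have dva s t : dot (v s) (alpha t) = (s == t)%:R by exact: hv.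
unshelve refine (ex_intro _ (@RootDatum R n alpha v a (undup rs) _ _ _ _ _ _ _ _ _ _) _) => //.
- exact: undup_uniq.
- by apply/negP => /memE; exact: (root_neq0 hPhi).
- move=> b k /memE bP /memE kP.
  have b0 : b != 0 by apply: contraPneq bP => ->; exact: (root_neq0 hPhi).
  have : (Phi `&` range (fun k : R => k *: b)) (k *: b) by split=> //; exists k.
  rewrite (root_line hPhi bP) => -[/= e|/= e]; [left|right]; apply/eqP.
    by rewrite -subr_eq0 -[_ == 0]orbF -(negPf b0) -scaler_eq0 scalerBl scale1r e subrr.
  by rewrite -subr_eq0 -[_ == 0]orbF -(negPf b0) -scaler_eq0 scalerBl scaleN1r e subrr.
- move=> b b' /memE bP /memE b'P; apply/memE; rewrite -(root_reflection hPhi bP).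
  by exists b' => //; rewrite reflectionE.
- by move=> s; apply/memE; exact: (simple_root halpha).
- exact: simple_span.
- move=> b /memE bP; have [k [-> hk]] := simple_sign halpha bP.
  have E s : dot (v s) (\sum_(t < n) k t *: alpha t) = k s.
    rewrite dot_sumr (bigD1 s) //= big1 => [|t ts].
      by rewrite dotZr dva eqxx mulr1 addr0.
    by rewrite dotZr dva eq_sym (negPf ts) mulr0.
  by case: hk => hk; [left|right] => s; rewrite E.
- exact: interior_dominant.
- move=> s t; rewrite -reflectionE; apply: hcryst; exact: (simple_root halpha).
Qed.

End Construction.

Theorem theorem3p15 (R : realType) (n : nat) (Phi : set 'cV[R]_n)
    (alpha v : 'I_n -> 'cV[R]_n) (c : seq 'I_n) (a : 'cV[R]_n)
    (hPhi : root_system Phi) (hcryst : crystallographic Phi)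
    (halpha : simple_system Phi alpha) (hv : fundamental_weights alpha v)
    (hc : coxeter_word c)
    (haL : root_lattice alpha a) (haD : (fundamental_chamber alpha)° a) :
  vertices (Perm alpha a) `<=` root_lattice alpha /\
  vertices (Ass alpha v c a) `<=` root_lattice alpha.
Proof.
have [d [ea ev eaa]] := root_datum_exists hPhi hcryst halpha hv haD.
move: haL; rewrite -ea -ev -eaa => aL.
have {}aL : in_lattice d (rd_a d) by apply/root_latticeE.
split=> z hz; apply/root_latticeE.
  exact: vertices_Perm.
exact: (vertices_Ass (coxeter_full hc)).
Qed.
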